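(* Let $0<\beta_1\le\beta_2\le n$. There exists a constant $C>0$, depending only on $\beta_1$, $\beta_2$ and $n$, such that if $f\in\mathrm{BMO}^{\beta_1}(\mathbb{R}^n)$ and $\mathcal{M}^{\beta_2}f$ is not identically infinite, then $$\|\mathcal{M}^{\beta_2}f\|_{\mathrm{BLO}^{\beta_1}(\mathbb{R}^n)}\le C\,\|f\|_{\mathrm{BMO}^{\beta_1}(\mathbb{R}^n)}.$$
   Context: All cubes are open with sides parallel to the coordinate axes; $\ell(Q)$ is the side length of $Q$. Dyadic Hausdorff content, for $\beta\in(0,n]$: with $\mathcal{D}_0=\{2^k(l+[0,1)^n):k\in\mathbb{Z},\,l\in\mathbb{Z}^n\}$, for $E\subset\mathbb{R}^n$, $\mathcal{H}_\infty^\beta(E)=\inf\{\sum_{i=1}^\infty\ell(Q_i)^\beta: E\subset\bigcup_i Q_i,\ Q_i\in\mathcal{D}_0\}$. For $f:\Omega\to[0,\infty]$, $\int_\Omega f\,d\mathcal{H}_\infty^\beta=\int_0^\infty\mathcal{H}_\infty^\beta(\{x\in\Omega:f(x)>t\})\,dt$. $\beta$-dimensional uncentered maximal function: $\mathcal{M}^\beta f(x)=\sup_{Q\ni x}\frac{1}{\mathcal{H}_\infty^\beta(Q)}\int_Q|f|\,d\mathcal{H}_\infty^\beta$, supremum over all cubes $Q\subset\mathbb{R}^n$ containing $x$. For $\Omega$ open, $f:\Omega\to\mathbb{R}$ is $\mathcal{H}_\infty^\beta$-quasicontinuous on $\Omega$ if for every $\epsilon>0$ there is an open set $O_\epsilon\subset\Omega$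 with $\mathcal{H}_\infty^\beta(O_\epsilon)<\epsilon$ and $f|_{\Omega\setminus O_\epsilon}$ continuous. $\mathrm{BMO}^\beta(\mathbb{R}^n)$ is the set of $f$ that are $\mathcal{H}_\infty^\beta$-quasicontinuous, $\mathcal{H}_\infty^\beta$-integrable on each finite cube, and satisfy $$\|f\|_{\mathrm{BMO}^\beta(\mathbb{R}^n)}=\sup_Q\inf_{c\in\mathbb{R}}\frac{1}{\mathcal{H}_\infty^\beta(Q)}\int_Q|f-c|\,d\mathcal{H}_\infty^\beta<\infty,$$ supremum over all finite cubes $Q\subset\mathbb{R}^n$. With $\operatorname{ess\,inf}_{\beta,A}\,g=\sup\{c\in\mathbb{R}:\mathcal{H}_\infty^\beta(\{x\in A:g(x)<c\})=0\}$, $$\|g\|_{\mathrm{BLO}^\beta(\mathbb{R}^n)}=\sup_Q\frac{1}{\mathcal{H}_\infty^\beta(Q)}\int_Q\big(g-\operatorname{ess\,inf}_{\beta,Q}\,g\big)\,d\mathcal{H}_\infty^\beta,$$ supremum over all finite cubes $Q\subset\mathbb{R}^n$. *)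

(* Defs.v *)
From HB Require Import structures.
From mathcomp Require Import all_boot all_order all_algebra.
From mathcomp Require Import all_classical all_reals all_analysis.
Set Implicit Arguments.
Unset Strict Implicit.
Unset Printing Implicit Defensive.
Import Order.TTheory GRing.Theory Num.Theory.
Import numFieldNormedType.Exports.
Local Open Scope classical_set_scope.
Local Open Scope ring_scope.

(* R^n is 'rV[R]_n; its topology is the product topology. *)
Section content.
Context {R : realType} {n : nat}.
Implicit Types (beta : R) (Q A E D : set 'rV[R]_n).

Definition cube (a : 'rV[R]_n) (r : R) : set 'rV[R]_n :=
  [set x | forall i, a ord0 i < x ord0 i < a ord0 i + r].

Definition cubes : set (set 'rV[R]_n) :=
  [set Q | exists a r, 0 < r /\ Q = cube a r].

(* 2^k (l + [0,1)^n), of side length 2^k *)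
Definition dyadic_cube (k : int) (l : 'rV[int]_n) : set 'rV[R]_n :=
  [set x | forall i, 2 ^ k * (l ord0 i)%:~R <= x ord0 i
                       < 2 ^ k * ((l ord0 i)%:~R + 1)].

(* The covering cubes are given by their parameters; when 0 < n a dyadic cube
   determines its side length, so no generality is lost. *)
Definition dyadic_content beta E : \bar R :=
  ereal_inf [set s | exists (k : nat -> int) (l : nat -> 'rV[int]_n),
    E `<=` \bigcup_i dyadic_cube (k i) (l i) /\
    s = (\sum_(0 <= i <oo) ((2 ^ k i) `^ beta)%:E)%E].

(* The integrand t |-> H(f > t) is nonincreasing, hence measurable. *)
Definition choquet_int beta D (f : 'rV[R]_n -> \bar R) : \bar R :=
  (\int[lebesgue_measure]_(t in `[0%R, +oo[)
     dyadic_content beta [set x | D x /\ (t%:E < f x)%E])%E.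

Definition choquet_avg beta Q (f : 'rV[R]_n -> \bar R) : \bar R :=
  ((dyadic_content beta Q)^-1 * choquet_int beta Q f)%E.

Definition maximal beta (f : 'rV[R]_n -> R) (x : 'rV[R]_n) : \bar R :=
  ereal_sup [set choquet_avg beta Q (fun y => `|f y|%:E) |
    Q in [set Q | cubes Q /\ Q x]].

(* {within D `\` O, continuous f} is continuity of the restriction of f for
   the subspace topology. *)
Definition quasicontinuous beta D (f : 'rV[R]_n -> R) : Prop :=
  forall e : R, 0 < e -> exists O : set 'rV[R]_n,
    [/\ open O, O `<=` D, (dyadic_content beta O < e%:E)%E
      & {within D `\` O, continuous f}].

Definition bmo_norm beta (f : 'rV[R]_n -> R) : \bar R :=
  ereal_sup [set ereal_inf
      (range (fun c : R => choquet_avg beta Q (fun x => `|f x - c|%:E))) |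
    Q in cubes].

Definition in_bmo beta (f : 'rV[R]_n -> R) : Prop :=
  [/\ quasicontinuous beta setT f,
      (forall Q, cubes Q -> (choquet_int beta Q (fun x => `|f x|%:E) < +oo)%E)
    & (bmo_norm beta f < +oo)%E].

Definition ess_inf_content beta A (g : 'rV[R]_n -> \bar R) : \bar R :=
  ereal_sup [set c%:E | c in
    [set c : R | dyadic_content beta [set x | A x /\ (g x < c%:E)%E] = 0%E]].

(* For extended-real-valued g the difference is taken in the dual scope, where
   +oo - +oo = +oo: a cube on which g is infinite almost everywhere gives an
   infinite oscillation instead of a null one, so that a bound on the norm is
   never obtained from an undefined difference. *)
Definition blo_norm beta (g : 'rV[R]_n -> \bar R) : \bar R :=
  ereal_sup [set choquet_avg beta Q
      (fun x => (g x - ess_inf_content beta Q g)%dE) |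
    Q in cubes].

End content.

(* Main.v *)
Require Import Defs.
From mathcomp Require Import all_boot all_order all_algebra.
From mathcomp Require Import all_classical all_reals all_analysis.
From mathcomp Require Import measurable_realfun ring lra zify.
Set Implicit Arguments.
Unset Strict Implicit.
Unset Printing Implicit Defensive.
Import Order.TTheory GRing.Theory Num.Theory.
Import numFieldNormedType.Exports.
Local Open Scope classical_set_scope.
Local Open Scope ring_scope.

(** Write H1, H2 for the contents of dimension beta1 <= beta2, w1(k) and w2(k)
for the weights [(2 ^ k) `^ beta1] and [(2 ^ k) `^ beta2] of a dyadic cell of
scale k, and let N be slightly larger than the BMO norm of f. Every dyadic cell
p gets a centre m(p), a real number for which the H1-average of |f - m(p)| over
the cube [star p], three times as large as p, is at most N up to a constant.

The whole estimate reduces to one exponential bound. For a cell p of scale k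
let T(p, lam) be the set of those x in p that lie in a cube P of side at most
2^k over which the H2-average of |f - m(p)| exceeds lam. Then, for a step L
proportional to N, the content H1 (T(p, j L)) is at most 2 * 2^-j * w1(k)
([tail_set_decay]). This plays the role of the John-Nirenberg inequality and of
the strong maximal inequality together.

The bound is proved by induction on j. By Chebyshev's inequality the set G of
points of p at which f is far from m(p) has small content. Take a nearly optimal
cover S of G by dyadic cells; call a cell q heavy when the members of S inside q
have total weight at least a fixed fraction of the weight of q, and
let M consist of the maximal heavy cells. Maximal heavy cells are disjoint, so
the weights of M add up to at most w1(k) / 2 ([calderon_zygmund]); this is the
point at which a content, which is not additive, is replaced by a sum of
weights, which is. A cell q that is not heavy meets G in a set smaller than q
itself, so it contains a point at which f is close to both m(p) and m(q), and
these two centres are close to one another. Hence a cube around x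
whose average is large is at most as large as a member of M that contains x, and
the centre of this member is still within a
multiple of N of m(p): the parent of a member of M is not heavy. This gives the
inclusion of T(p, lam + L) in the union of the sets T(q, lam), q in M
([tail_set_step]).

Three facts about the content are used. The first is that a dyadic cell has
content comparable to its weight ([le_content_cell]). The lower bound is a
compactness argument: if the weights of a cover were too small, one could
descend from cell to subcell, always keeping less than a full weight of cover
inside, and reach a point that is not covered. The second is that
H2 / w2(k) is bounded by a multiple of H1 / w1(k) on sets of scale k
([content_exponent_le]), so averages of dimension beta2 are controlled by
averages of dimension beta1. The third is that the Choquet integral behaves
well with respect to constants ([choquet_le_add], [choquet_ge_const]); it
follows by comparing the integral with sums over equally spaced levels.

Finally take a cube Q and points x, y in Q. A large cube P containing x gives
an average at most M f (y) + O(N), since a cube around P that contains y has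
nearly the same centre; a small cube P gives the same unless x lies in a set
T(q, j L) for one of the at most 2^n cells q of the scale of Q that meet Q.
Hence M f exceeds M f (y) + O(N) + j L on a subset of Q of content at most
C * 2^-j * H1(Q) ([maximal_tail]). Choosing y so that M f (y) is almost the
essential infimum and summing over j gives the theorem. The same tail bound, in
a cube containing a point at which M f is finite, shows that the essential
infimum is finite. *)

(** * Sums over arbitrary sets of indices *)

Section sums.
Context {R : realType}.

Lemma subset_esum (T : choiceType) (A B : set T) (a : T -> \bar R) :
  A `<=` B -> (forall x, 0 <= a x)%E ->
  (\esum_(i in A) a i <= \esum_(i in B) a i)%E.
Proof.
move=> AB a0; rewrite [leRHS](esumID A)// setIidr//.
by rewrite leeDl// esum_ge0.
Qed.

(** An index that belongs to several of the sets is counted once on the left, so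
choosing for each index one of the sets that contain it embeds the left sum in
the right one. *)
Lemma le_esum_bigcup (T1 T2 : choiceType) (K : set T1)
    (J : T1 -> set T2) (a : T2 -> \bar R) : (forall x, 0 <= a x)%E ->
  (\esum_(j in \bigcup_(k in K) J k) a j <=
   \esum_(k in K) \esum_(j in J k) a j)%E.
Proof.
move=> a0; rewrite (esum_esum (a := fun _ j => a j))//.
have /choice[h hP] : forall j, exists k : option T1,
    (\bigcup_(k in K) J k) j -> exists2 k', k = Some k' & K k' /\ J k' j.
  move=> j; have [[k Kk Jk]|nj] := pselect ((\bigcup_(k in K) J k) j).
    by exists (Some k) => _; exists k.
  by exists None.
have [[k0 Kk0]|K0] := pselect (exists k, K k); last first.
  rewrite (_ : \bigcup_(_ in _) _ = set0) ?esum_set0 ?esum_ge0//.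
  by rewrite -subset0 => j [k Kk _]; apply: K0; exists k.
(* the default [k0] is used only outside the union *)
pose g j := (odflt k0 (h j), j).
rewrite -(esum_image (\bigcup_(k in K) J k) g (fun p => a p.2)); last first.
  by move=> x y _ _ [_ ->].
apply: subset_esum => //= _ [j Uj <-] /=.
by have [k hk [Kk Jk]] := hP j Uj; rewrite /g hk.
Qed.

Lemma le_esum_term (T : choiceType) (A : set T) (a : T -> \bar R) t :
  (forall x, 0 <= a x)%E -> A t -> (a t <= \esum_(i in A) a i)%E.
Proof.
move=> a0 At; rewrite -[leLHS]esum_set1//.
by apply: subset_esum => // _ ->.
Qed.

Lemma le_esum_disjoint (T1 T2 : choiceType) (K : set T1)
    (J : T1 -> set T2) (B : set T2) (a : T2 -> \bar R) :
  (forall x, 0 <= a x)%E -> (forall k j, K k -> J k j -> B j) ->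
  (forall k k' j, K k -> K k' -> J k j -> J k' j -> k = k') ->
  (\esum_(k in K) \esum_(j in J k) a j <= \esum_(j in B) a j)%E.
Proof.
move=> a0 JB dJ; rewrite (esum_esum (a := fun _ j => a j))//.
rewrite -(esum_image (K `*`` J) snd a).
  by apply: subset_esum => // _ [[k j] [/= Kk Jj] <-]; exact: JB Jj.
move=> [k j] [k' j'] /set_mem[/= Kk Jj] /set_mem[/= Kk' Jj'] jj'.
by rewrite -{}jj' in Jj' *; rewrite (dJ _ _ _ Kk Kk' Jj Jj').
Qed.

Lemma esum_range_le (T : choiceType) (e : nat -> T)
    (a : T -> \bar R) : (forall x, 0 <= a x)%E ->
  (\esum_(j in range e) a j <= \sum_(0 <= i <oo) a (e i))%E.
Proof.
move=> a0; rewrite (_ : range e = \bigcup_(i in setT) [set e i]); last first.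
  by apply/seteqP; split=> [_ [i _ <-]|x [i _ ->]]; exists i.
rewrite (le_trans (le_esum_bigcup _ _ _))// nneseries_esumT//.
by apply: le_esum => i _; rewrite esum_set1.
Qed.

Lemma esumZl_le (T : choiceType) (A : set T) (c : R) (u : T -> \bar R) :
  0 <= c -> (forall t, 0 <= u t)%E ->
  (\esum_(t in A) (c%:E * u t) <= c%:E * \esum_(t in A) u t)%E.
Proof.
move=> c0 u0; apply: ge_ereal_sup => _ [X [finX XA] <-].
rewrite -ge0_mule_fsumr//; apply: lee_wpmul2l; first by rewrite lee_fin.
by apply: ereal_sup_ubound; exists X.
Qed.

Lemma esum_fin_const (T : finType) (c : \bar R) : (0 <= c)%E ->
  (\esum_(i in [set: T]) c = (#|T|%:R)%:E * c)%E.
Proof.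
move=> c0; rewrite esum_fset//; last exact: finite_finset.
rewrite (_ : [set: T] = [set` enum T]); last first.
  by apply/seteqP; split=> x //= _; rewrite mem_enum.
rewrite -fsbig_seq ?enum_uniq// cardE.
elim: (enum T) => [|t r IH]; first by rewrite big_nil mul0e.
by rewrite big_cons IH /= -natr1 EFinD ge0_muleDl ?lee_fin// mul1e addeC.
Qed.

Lemma sum_nat_const_ereal (M : nat) (c : \bar R) : (0 <= c)%E ->
  (\sum_(0 <= i < M) c = M%:R%:E * c)%E.
Proof.
move=> c0; elim: M => [|M IH]; first by rewrite big_nil mul0e.
by rewrite big_nat_recr//= IH -natr1 EFinD ge0_muleDl ?lee_fin// mul1e.
Qed.

End sums.

(** * Dyadic cells *)

Section dyadic.
Context {R : realType} {n : nat}.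
Implicit Types (beta : R) (x y : 'rV[R]_n) (k : int) (p q : int * 'rV[int]_n).

Lemma pow2_gt0 k : 0 < 2 ^ k :> R.
Proof. exact: exprz_gt0. Qed.

Lemma pow2D k k' : 2 ^ (k + k') = 2 ^ k * 2 ^ k' :> R.
Proof. by rewrite expfzDr. Qed.

Lemma pow2S k : 2 ^ (k + 1) = 2 * 2 ^ k :> R.
Proof. by rewrite pow2D expr1z mulrC. Qed.

Lemma pow2_half k : 2 ^ k = 2 * 2 ^ (k - 1) :> R.
Proof. by rewrite -pow2S subrK. Qed.

Lemma le_pow2 k k' : k <= k' -> 2 ^ k <= 2 ^ k' :> R.
Proof. by move=> kk'; rewrite ler_eXz2l// ltr1n. Qed.

Lemma dyadic_scale (r : R) : 0 < r -> exists k, 2 ^ (k - 1) < r <= 2 ^ k.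
Proof.
move=> r0; have l2 : 0 < ln (2 : R) by rewrite ln_gt0// ltr1n.
exists (Num.ceil (ln r / ln 2)).
have /andP[h1 h2] := ceil_itv (ln r / ln 2).
have E z : (2 : R) ^ z = expR (z%:~R * ln 2).
  by rewrite -powR_intmul// /powR pnatr_eq0.
rewrite -[X in _ < X <= _](lnK r0) !E ltr_expR ler_expR.
by rewrite -ltr_pdivlMr// h1 -ler_pdivrMr.
Qed.

Lemma exp2_unbounded (X : R) : exists j : nat, X < 2 ^+ j.
Proof.
exists (Num.truncn X).+1; apply: (@lt_trans _ _ (Num.truncn X).+1%:R).
  have [X0|X0] := leP 0 X; last by apply: lt_le_trans X0 _.
  by have /andP[] := truncn_itv X0.
by rewrite -natrX ltr_nat ltn_expl.
Qed.

Definition cell p : set 'rV[R]_n := dyadic_cube p.1 p.2.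

Definition loc k x : 'rV[int]_n := \row_i Num.floor (x ord0 i / 2 ^ k).

(** The cells of scale [k] are the fibres of [loc k], which makes their
disjointness and nesting statements about the function [loc k]. *)
Lemma cellP p x : cell p x <-> loc p.1 x = p.2.
Proof.
case: p => k l; rewrite /cell/=.
have E i : (2 ^ k * (l ord0 i)%:~R <= x ord0 i < 2 ^ k * ((l ord0 i)%:~R + 1))
  = (Num.floor (x ord0 i / 2 ^ k) == l ord0 i).
  rewrite floor_eq ler_pdivlMr ?pow2_gt0// ltr_pdivrMr ?pow2_gt0//.
  by rewrite intrD [_ * 2 ^ k]mulrC [X in _ < X]mulrC.
split=> [h|lx i].
  by apply/rowP => i; rewrite mxE; apply/eqP; rewrite -E; exact: h.
by rewrite /= E -lx mxE.
Qed.

Lemma cell_loc k x : cell (k, loc k x) x.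
Proof. exact/cellP. Qed.

Lemma le_loc_coarsen k k' x y i : k <= k' -> loc k x = loc k y ->
  loc k' x ord0 i <= loc k' y ord0 i.
Proof.
move=> kk' /rowP/(_ i); rewrite !mxE => xy.
rewrite floor_ge_int ler_pdivlMr ?pow2_gt0//.
set m := Num.floor (x _ _ / 2 ^ k').
have : m%:~R <= x ord0 i / 2 ^ k' by exact: floor_le.
rewrite ler_pdivlMr ?pow2_gt0// => mx.
have [j jE] : exists j : nat, k' = k + j%:Z.
  by exists `|k' - k|%N; lia.
have E : (m * 2 ^+ j)%:~R * 2 ^ k = m%:~R * 2 ^ k' :> R.
  by rewrite jE pow2D intrM -mulrA; congr (_ * _); rewrite mulrC; congr (_ * _);
    rewrite rmorphXn.
rewrite -E -ler_pdivlMr ?pow2_gt0// -floor_ge_int -xy floor_ge_int.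
by rewrite ler_pdivlMr ?pow2_gt0// E.
Qed.

Lemma loc_coarsen k k' x y : k <= k' -> loc k x = loc k y ->
  loc k' x = loc k' y.
Proof.
move=> kk' xy; apply/rowP => i; apply/eqP; rewrite eq_le.
by rewrite !(le_loc_coarsen _ kk').
Qed.

Lemma cell_nested p q x : p.1 <= q.1 -> cell p x -> cell q x ->
  cell p `<=` cell q.
Proof.
move=> pq /cellP px /cellP qx y /cellP py; apply/cellP.
by rewrite -qx; apply: loc_coarsen pq _; rewrite px py.
Qed.

Definition corner p : 'rV[R]_n := \row_i (2 ^ p.1 * (p.2 ord0 i)%:~R).

Lemma cell_corner p : cell p (corner p).
Proof.
by move=> i; rewrite mxE lexx/= ltr_pM2l ?pow2_gt0// ltrDl.
Qed.

Definition weight beta k : R := (2 ^ k) `^ beta.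

Lemma weight_gt0 beta k : 0 < weight beta k.
Proof. by rewrite powR_gt0// pow2_gt0. Qed.

Lemma weight_ge0 beta k : 0 <= weight beta k.
Proof. exact/ltW/weight_gt0. Qed.

Lemma le_weight beta k k' : 0 <= beta -> k <= k' ->
  weight beta k <= weight beta k'.
Proof.
move=> b0 kk'; apply: ge0_ler_powR (le_pow2 kk') => //.
- by rewrite nnegrE ltW ?pow2_gt0.
- by rewrite nnegrE ltW ?pow2_gt0.
Qed.

Lemma weightS beta k : weight beta (k + 1) = 2 `^ beta * weight beta k.
Proof. by rewrite /weight pow2S powRM// ltW// pow2_gt0. Qed.

Lemma weightS_le beta k : beta <= n%:R ->
  weight beta (k + 1) <= 2 ^+ n * weight beta k.
Proof.
move=> bn; rewrite weightS ler_wpM2r ?weight_ge0//.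
by rewrite -powR_mulrn// ler_powR// ler1n.
Qed.

Lemma weightSS_le beta k : beta <= n%:R ->
  weight beta (k + 2) <= 4 ^+ n * weight beta k.
Proof.
move=> bn; rewrite (_ : k + 2 = k + 1 + 1); last by rewrite -addrA.
rewrite (le_trans (weightS_le _ bn))// (_ : 4 = 2 * 2 :> R); last by ring.
by rewrite exprMn -mulrA ler_wpM2l ?exprn_ge0// weightS_le.
Qed.

Lemma small_weight beta (e : R) : 0 < beta -> 0 < e ->
  exists k, weight beta k <= e.
Proof.
move=> b0 e0; have [k /andP[h _]] := dyadic_scale (powR_gt0 beta^-1 e0).
exists (k - 1); rewrite -[leRHS](powRr1 (ltW e0)) -(mulVf (lt0r_neq0 b0)).
rewrite powRrM; apply: ge0_ler_powR; rewrite ?nnegrE ?(ltW b0)//.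
- by rewrite ltW// pow2_gt0.
- by rewrite powR_ge0.
- by rewrite ltW.
Qed.

(** * Elementary properties of the dyadic content *)

Implicit Types (a : 'rV[R]_n) (E F D Q : set 'rV[R]_n) (A : set (int * 'rV[int]_n)).

Definition cell_weight beta p : \bar R := (weight beta p.1)%:E.

Lemma cell_weight_ge0 beta p : (0 <= cell_weight beta p)%E.
Proof. by rewrite lee_fin weight_ge0. Qed.

Definition covered A : set 'rV[R]_n := \bigcup_(p in A) cell p.

Local Notation H := dyadic_content.

Lemma content_ge0 beta E : (0 <= H beta E)%E.
Proof.
apply: le_ereal_inf_tmp => _ [k [l [_ ->]]].
by apply: nneseries_ge0 => i _ _; rewrite lee_fin powR_ge0.
Qed.

Lemma le_content beta E F : E `<=` F -> (H beta E <= H beta F)%E.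
Proof.
move=> EF; apply: le_ereal_inf => _ [k [l [FU ->]]].
by exists k, l; split=> //; exact: subset_trans EF FU.
Qed.

(** Together with [content_le_esum] this replaces the sequences of cells in the
definition of the content by sets of cells, which can be split, reindexed and
selected from. *)
Lemma content_cover beta E (s : \bar R) : (H beta E < s)%E ->
  exists A, E `<=` covered A /\ (\esum_(p in A) cell_weight beta p < s)%E.
Proof.
move=> /ereal_inf_lt [_ [k [l [EU ->]]] Hs].
exists (range (fun i => (k i, l i))); split.
  by move=> x /EU [i _ ix]; exists (k i, l i) => //; exists i.
by apply: le_lt_trans Hs; apply: esum_range_le; exact: cell_weight_ge0.
Qed.

(** A set of cells may be finite or empty while the definition of the content
asks for an infinite sequence; the missing terms are filled with cells of
arbitrarily small total weight. *)
Lemma content_le_esum beta E A : 0 < beta ->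
  E `<=` covered A -> (H beta E <= \esum_(p in A) cell_weight beta p)%E.
Proof.
move=> b0 EA; apply/lee_addgt0Pr => e e0.
have e20 i : 0 < e / (2 ^ i.+1)%:R by rewrite divr_gt0// ltr0n expn_gt0.
have /choice[t ht] i := small_weight b0 (e20 i).
(* the sum over [A] is enumerated along the codes of its cells; codes that are not
used receive the tiny cells [(t i, 0)] *)
pose a i := if pickle_inv i is Some p then if p \in A then cell_weight beta p else 0%E
            else 0%E.
pose c i : int * 'rV[int]_n := if pickle_inv i is Some p then
  if p \in A then p else (t i, 0) else (t i, 0).
have a0 i : (0 <= a i)%E.
  by rewrite /a; case: pickle_inv => // p; case: ifP => // _; exact: cell_weight_ge0.
have aE : (\sum_(0 <= i <oo) a i = \esum_(p in A) cell_weight beta p)%E.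
  rewrite nneseries_esumT// (esumID [set m | exists2 p, p \in A & pickle_inv m = Some
    p])//.
  rewrite setTI (_ : [set m | _] = pickle @` A); last first.
    apply/seteqP; split=> [m [p Ap pm]|_ [p Ap <-]].
      exists p; first by rewrite -inE.
      by have := @pickle_invK (int * 'rV[int]_n)%type m; rewrite pm.
    by exists p; rewrite ?inE// pickleK_inv.
  rewrite (esum1 (D := _ `&` _)) ?adde0.
    rewrite esum_image; last by move=> p q _ _ /(pcan_inj pickleK_inv).
    by apply: eq_esum => p Ap; rewrite /a pickleK_inv mem_set.
  move=> m [_ mA]; rewrite /a; case E1 : (pickle_inv m) => [p|//].
  case: ifPn => // pA; exfalso; apply: mA; exists p; first by rewrite -inE.
  by have := @pickle_invK (int * 'rV[int]_n)%type m; rewrite E1.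
apply: (@le_trans _ _ (\sum_(0 <= i <oo) cell_weight beta (c i))%E).
  apply: ereal_inf_lbound; exists (fun i => (c i).1), (fun i => (c i).2).
  split=> // x /EA [p Ap px]; exists (pickle p) => //.
  by rewrite /c pickleK_inv mem_set.
rewrite -aE; apply: le_trans (epsilon_trick _ _ (ltW e0)) => //.
apply: lee_nneseries => [i _ _|i _]; first exact: cell_weight_ge0.
rewrite /a /c; case: pickle_inv => [p|]; last by rewrite add0e lee_fin ht.
case: ifP => _; last by rewrite add0e lee_fin ht.
by rewrite leeDl// lee_fin ltW.
Qed.

Lemma content0 beta : 0 < beta -> H beta (set0 : set 'rV[R]_n) = 0%E.
Proof.
move=> b0; apply/eqP; rewrite eq_le content_ge0 andbT.
by rewrite (le_trans (content_le_esum (A := set0) b0 _))// esum_set0.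
Qed.

Lemma content_cell_le beta p : 0 < beta -> (H beta (cell p) <= cell_weight beta p)%E.
Proof.
move=> b0; rewrite (le_trans (content_le_esum (A := [set p]) b0 _))//.
  by move=> x px; exists p.
by rewrite esum_set1 ?cell_weight_ge0.
Qed.

(** The strict bounds leave room for choosing an almost optimal cover of each
set. *)
Lemma content_bigcup_lt beta (T : choiceType) (K : set T) (S : T -> set 'rV[R]_n)
    (s : T -> \bar R) : 0 < beta ->
  (forall q : T, K q -> (H beta (S q) < s q)%E) ->
  (H beta (\bigcup_(q in K) S q) <= \esum_(q in K) s q)%E.
Proof.
move=> b0 HS.
have /choice[A hA] (q : T) : exists A, K q ->
    S q `<=` covered A /\ (\esum_(p in A) cell_weight beta p < s q)%E.
  have [Kq|nK] := pselect (K q); last by exists set0.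
  by have [A hA] := content_cover (HS q Kq); exists A.
apply: (@le_trans _ _ (\esum_(p in \bigcup_(q in K) A q) cell_weight beta p)%E).
  apply: content_le_esum => // x [q Kq /(hA _ Kq).1 [p Ap px]].
  by exists p => //; exists q.
apply: le_trans (le_esum_bigcup _ _ _) _; first exact: cell_weight_ge0.
by apply: le_esum => q Kq; exact/ltW/(hA _ Kq).2.
Qed.

Lemma contentU beta E F : 0 < beta ->
  (H beta (E `|` F) <= H beta E + H beta F)%E.
Proof.
move=> b0.
have [EE|EE] := eqVneq (H beta E) +oo%E.
  by rewrite EE addye ?leey// gt_eqF// (lt_le_trans _ (content_ge0 _ _)).
have [FF|FF] := eqVneq (H beta F) +oo%E.
  by rewrite FF addey ?leey// gt_eqF// (lt_le_trans _ (content_ge0 _ _)).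
have Ef : H beta E \is a fin_num by rewrite ge0_fin_numE ?content_ge0// lt_neqAle EE
  leey.
have Ff : H beta F \is a fin_num by rewrite ge0_fin_numE ?content_ge0// lt_neqAle FF
  leey.
apply/lee_addgt0Pr => e e0.
pose e2 := (e / 2)%:E.
have e20 : (0 < e2)%E by rewrite lte_fin divr_gt0.
have [A [EA sA]] : exists A, E `<=` covered A /\
  (\esum_(p in A) cell_weight beta p < H beta E + e2)%E.
  by apply: content_cover; rewrite lteDl.
have [B [FB sB]] : exists A, F `<=` covered A /\
  (\esum_(p in A) cell_weight beta p < H beta F + e2)%E.
  by apply: content_cover; rewrite lteDl.
apply: (@le_trans _ _ (\esum_(p in A `|` B) cell_weight beta p)%E).
  apply: content_le_esum => // x [/EA|/FB] [p pA px]; exists p => //.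
  - by left.
  - by right.
rewrite [leRHS](_ : _ = (H beta E + e2) + (H beta F + e2))%E; last first.
  by rewrite addeACA; congr (_ + _)%E; rewrite -EFinD -splitr.
apply: le_trans (leeD (ltW sA) (ltW sB)).
rewrite -bigcup2E.
apply: le_trans (le_esum_bigcup _ _ _) _; first exact: cell_weight_ge0.
rewrite -nneseries_esumT; last by move=> i; apply: esum_ge0 => *;
  exact: cell_weight_ge0.
rewrite (nneseries_split _ 2); last by move=> i _; apply: esum_ge0 => *;
  exact: cell_weight_ge0.
rewrite add0n !big_nat_recr//= big_geq// add0e eseries0 ?adde0// => -[|[|i]]//= _ _.
by rewrite esum_set0.
Qed.

Lemma le_contentU beta E F1 F2 : 0 < beta -> E `<=` F1 `|` F2 ->
  (H beta E <= H beta F1 + H beta F2)%E.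
Proof. by move=> b0 EF; apply: le_trans (contentU _ _ b0); exact: le_content. Qed.

(** * The content of a dyadic cell *)

Definition child p (d : {ffun 'I_n -> bool}) : int * 'rV[int]_n :=
  (p.1 - 1, \row_i (2 * p.2 ord0 i + (d i)%:Z)).

Lemma child_sub p d : cell (child p d) `<=` cell p.
Proof.
move=> x hx i; have := hx i; rewrite /= !mxE.
have k0 := pow2_gt0 (p.1 - 1).
rewrite (pow2_half p.1).
rewrite intrD intrM.
have : ((d i)%:Z%:~R = 0 :> R) \/ ((d i)%:Z%:~R = 1 :> R).
  by case: (d i); [right|left].
move=> [->|->]; nra.
Qed.

Lemma child_inj p d d' x : cell (child p d) x -> cell (child p d') x -> d = d'.
Proof.
move=> /cellP/= e /cellP/=; rewrite {}e => /rowP h; apply/ffunP => i.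
by have := h i; rewrite !mxE => /addrI; case: (d i) (d' i) => [] [].
Qed.

Lemma le_esum_children beta A p :
  (\esum_(d in [set: {ffun 'I_n -> bool}])
     \esum_(s in [set s | A s /\ cell s `<=` cell (child p d)]) cell_weight beta s <=
   \esum_(s in [set s | A s /\ cell s `<=` cell p]) cell_weight beta s)%E.
Proof.
apply: le_esum_disjoint => [|d s _ [As sd]|d d' s _ _ [_ h] [_ h']].
- exact: cell_weight_ge0.
- by split; [exact: As|apply: (subset_trans sd); exact: child_sub].
- have c := cell_corner s; exact: child_inj (h _ c) (h' _ c).
Qed.

(** The weights of the children of [p] add up to at least the weight of [p],
because [beta] does not exceed the dimension. A family of cells that is light
inside [p] is therefore light inside one of the children. *)
Lemma underweight_child beta A p : beta <= n%:R ->
  (\esum_(s in [set s | A s /\ cell s `<=` cell p]) cell_weight beta s < cell_weight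
    beta p)%E ->
  exists d, (\esum_(s in [set s | A s /\ cell s `<=` cell (child p d)]) cell_weight
    beta s
    < cell_weight beta (child p d))%E.
Proof.
move=> bn; apply: contraPP => /forallNP hd; apply/negP; rewrite -leNgt.
apply: le_trans (le_esum_children _ _ _).
apply: (@le_trans _ _ (\esum_(d in [set: {ffun 'I_n -> bool}])
     cell_weight beta (p.1 - 1, 0)%R)%E); last first.
  by apply: le_esum => d _; rewrite leNgt; exact/negP/hd.
rewrite esum_fin_const ?cell_weight_ge0// card_ffun card_bool card_ord -EFinM lee_fin
  natrX.
by rewrite -{1}(subrK 1 p.1) weightS_le.
Qed.

Definition shift (d : {ffun 'I_n -> bool}) p : int * 'rV[int]_n :=
  (p.1, p.2 - \row_i (d i)%:Z).

Lemma shift_inj d : injective (shift d).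
Proof. by move=> [k l] [k' l'] [-> /addIr ->]. Qed.

Lemma esum_shift beta A :
  (\esum_(s in \bigcup_(d in [set: {ffun 'I_n -> bool}]) (shift d @` A)) cell_weight
    beta s
   <= (2 ^+ n)%:E * \esum_(s in A) cell_weight beta s)%E.
Proof.
apply: le_trans (le_esum_bigcup _ _ _) _; first exact: cell_weight_ge0.
rewrite (eq_esum (b := fun=> \esum_(s in A) cell_weight beta s)).
  rewrite esum_fin_const ?card_ffun ?card_bool ?card_ord ?natrX//.
  by apply: esum_ge0 => *; exact: cell_weight_ge0.
by move=> d _; rewrite esum_image// => s s' _ _; exact: shift_inj.
Qed.

Section descent.
Variables (q : nat -> int * 'rV[int]_n) (d : nat -> {ffun 'I_n -> bool}).
Hypothesis qS : forall j, q j.+1 = child (q j) (d j).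

Lemma descent_scale j : (q j).1 = (q 0%N).1 - j%:Z.
Proof. by elim: j => [|j IH]; [rewrite subr0|rewrite qS/= IH; lia]. Qed.

Lemma descent_sub i j : (i <= j)%N -> cell (q j) `<=` cell (q i).
Proof.
elim: j => [|j IH]; first by rewrite leqn0 => /eqP ->.
rewrite leq_eqVlt => /predU1P[->//|/IH]; apply: subset_trans.
by rewrite qS; exact: child_sub.
Qed.

(** The cells are half-open, so the limit point is only in the closure of each
of them. *)
Lemma descent_point : exists x, forall j i,
  2 ^ (q j).1 * ((q j).2 ord0 i)%:~R <= x ord0 i
    <= 2 ^ (q j).1 * (((q j).2 ord0 i)%:~R + 1).
Proof.
pose y i : set R := range (fun j => corner (q j) ord0 i).
have yz i j j' : corner (q j') ord0 i <= 2 ^ (q j).1 * (((q j).2 ord0 i)%:~R + 1).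
  have [jj'|/ltnW j'j] := leqP j j'.
    have := descent_sub jj' (cell_corner (q j')) => /(_ i) /andP[_ /ltW].
    exact: le_trans.
  have := descent_sub j'j (cell_corner (q j)) => /(_ i) /andP[h _].
  rewrite mxE; apply: le_trans h _; have /andP[_ /ltW] := cell_corner (q j) i.
  exact: le_trans.
(* the corners increase in each coordinate and stay below every upper face *)
exists (\row_i sup (y i)) => j i; rewrite mxE; apply/andP; split.
  have -> : 2 ^ (q j).1 * ((q j).2 ord0 i)%:~R = corner (q j) ord0 i by rewrite mxE.
  apply: ub_le_sup; last by exists j.
  by exists (2 ^ (q 0%N).1 * (((q 0%N).2 ord0 i)%:~R + 1)) => _ [j' _ <-].
apply: ge_sup; first by exists (corner (q 0%N) ord0 i), 0%N.
by move=> _ [j' _ <-].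
Qed.

End descent.

Lemma sub_neq_int (u v : int) : u <= v + 1 -> v < u + 1 ->
  u - (u != v)%:Z = v.
Proof. by case: eqVneq => [->|]; lia. Qed.

(** Suppose that a cover of [p] has too small a weight. Add to each of its cells
the neighbours at its lower faces: the enlarged family is still light in a child
of [p], hence along a descending sequence of cells starting from that child. The
limit point of the sequence lies in some cell [s] of the cover. The member of
the sequence that has the size of [s] has the limit point in its closure, so it
is [s] or one of the added neighbours; but then the family is not light in
it. *)
Lemma le_content_cell beta p : 0 < beta -> beta <= n%:R ->
  (((4 ^+ n)^-1)%:E * cell_weight beta p <= H beta (cell p))%E.
Proof.
move=> b0 bn; rewrite leNgt; apply/negP => /content_cover [A [pA sA]].
have c0 : 0 < (4 ^+ n)^-1 :> R by rewrite invr_gt0 exprn_gt0.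
pose B := \bigcup_(d in [set: {ffun 'I_n -> bool}]) (shift d @` A).
pose mu s := (\esum_(t in [set t | B t /\ cell t `<=` cell s]) cell_weight beta t)%E.
(* the closure of this child, whose upper faces are not faces of [p], is inside [p];
thus the limit point of the descent is covered *)
pose q0 := child p [ffun=> false].
have mu0 : (mu q0 < cell_weight beta q0)%E.
  apply: (@le_lt_trans _ _ (\esum_(s in B) cell_weight beta s)%E).
    by apply: subset_esum => [s []//|]; exact: cell_weight_ge0.
  apply: le_lt_trans (esum_shift _ _) _.
  apply: (@lt_le_trans _ _ ((2 ^+ n)%:E * (((4 ^+ n)^-1)%:E * cell_weight beta p))%E).
    by rewrite lte_pmul2l// lte_fin exprn_gt0.
  rewrite -!EFinM lee_fin/= mulrA -ler_pdivlMl; last first.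
    by rewrite mulr_gt0// exprn_gt0.
  rewrite invfM invrK -[X in weight _ X](subrK 1 p.1).
  apply: le_trans (weightS_le _ bn) _.
  rewrite ler_wpM2r ?weight_ge0// (_ : 4 = 2 * 2 :> R); last by ring.
  by rewrite exprMn mulrA mulVf ?mul1r// expf_neq0.
have /choice[d hd] s : exists d, (mu s < cell_weight beta s)%E ->
    (mu (child s d) < cell_weight beta (child s d))%E.
  have [h|h] := boolP (mu s < cell_weight beta s)%E; last by exists [ffun=> false].
  by have [d hd] := underweight_child bn h; exists d.
pose q j := iter j (fun s => child s (d s)) q0.
have qS j : q j.+1 = child (q j) (d (q j)) by rewrite /q iterS.
have muq j : (mu (q j) < cell_weight beta (q j))%E.
  by elim: j => [//|j IH]; rewrite qS; exact: hd.
have [x hx] := descent_point qS.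
have /pA[s As sx] : cell p x.
  move=> i; have := hx 0%N i; rewrite /q/= !mxE ffunE addr0 intrM.
  have k0 := pow2_gt0 (p.1 - 1).
  by rewrite (pow2_half p.1); nra.
(* a cell as large as [p] is too heavy to belong to the cover *)
have [ps|sp] := leP p.1 s.1.
  have : (cell_weight beta s < cell_weight beta p)%E.
    apply: (@le_lt_trans _ _ (\esum_(s in A) cell_weight beta s)%E).
      by apply: le_esum_term => //; exact: cell_weight_ge0.
    apply: (lt_le_trans sA); rewrite -EFinM lee_fin ger_pMl ?weight_gt0//.
    by rewrite invf_le1 ?exprn_gt0// exprn_ege1// ler1n.
  by rewrite ltNge lee_fin le_weight// ltW.
(* the step of the descent that reaches the scale of [s] *)
pose j := absz (p.1 - 1 - s.1)%R.
have jE : (q j).1 = s.1 by rewrite (descent_scale qS)/= /j; lia.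
pose e : {ffun 'I_n -> bool} := [ffun i => s.2 ord0 i != (q j).2 ord0 i].
have Bq : B (q j).
  exists e => //; exists s => //; rewrite /shift -jE [q j]surjective_pairing/=.
  congr (_, _); apply/rowP => i; rewrite !mxE ffunE.
  have /andP[h1 h2] := hx j i; have /andP[h3 h4] := sx i.
  have k0 := pow2_gt0 s.1.
  rewrite jE in h1 h2.
  have : (q j).2 ord0 i < s.2 ord0 i + 1.
    by rewrite -(ltr_int R) intrD -(ltr_pM2l k0); exact: le_lt_trans h1 h4.
  have : s.2 ord0 i <= (q j).2 ord0 i + 1.
    by rewrite -(ler_int R) intrD -(ler_pM2l k0); exact: le_trans h3 h2.
  exact: sub_neq_int.
have := muq j; rewrite ltNge => /negP; apply.
apply: (@le_esum_term _ _ [set t | B t /\ cell t `<=` cell (q j)]);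
  first exact: cell_weight_ge0.
by split.
Qed.

(** * The content of a cube *)

Lemma sub_cube_cells a (r : R) k : r <= 2 ^ k ->
  cube a r `<=` \bigcup_(d in [set: {ffun 'I_n -> bool}])
    cell (k, loc k a + \row_i (d i)%:Z).
Proof.
move=> rk x ax.
have k0 : 0 < 2 ^ k :> R := pow2_gt0 k.
exists [ffun i => loc k x ord0 i != loc k a ord0 i] => //.
apply/cellP/rowP => i; rewrite /= !mxE ffunE !mxE.
have /andP[h1 h2] := ax i.
set u := Num.floor _; set v := Num.floor _.
have h3 : v <= u.
  by rewrite /u floor_ge_int ler_pdivlMr// (le_trans _ (ltW h1))// -ler_pdivlMr//
    floor_le.
have h4 : u <= v + 1.
  rewrite -ltzD1 floor_lt_int ltr_pdivrMr// (lt_le_trans h2)//.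
  rewrite (le_trans (lerD (lexx _) rk))// intrD mulrDl mul1r lerD2r.
  by rewrite -ler_pdivrMr// ltW// floorD1_gt.
have [->|uv] := eqVneq u v; first by rewrite addr0.
by move: uv; clear -h3 h4; move: u v h3 h4 => u v; lia.
Qed.

Lemma content_finite_union beta (T : finType)
    (S : set 'rV[R]_n) (E : T -> set 'rV[R]_n) (s : R) :
  0 < beta -> 0 <= s -> S `<=` \bigcup_(d in [set: T]) E d ->
  (forall d, H beta (E d) < s%:E)%E -> (H beta S <= (#|T|%:R * s)%:E)%E.
Proof.
move=> b0 s0 SE HE; apply: le_trans (le_content _ SE) _.
apply: le_trans (content_bigcup_lt (s := fun=> s%:E) b0 _) _ => //.
by rewrite esum_fin_const ?lee_fin// EFinM.
Qed.

Lemma content_cube_le beta a (r : R) k : 0 < beta -> r <= 2 ^ k ->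
  (H beta (cube a r) <= (2 ^+ n * weight beta k)%:E)%E.
Proof.
move=> b0 rk.
have sub := sub_cube_cells (a := a) rk.
pose l (d : {ffun 'I_n -> bool}) := (k, loc k a + \row_i (d i)%:Z).
apply: (@le_trans _ _ (\esum_(p in range l) cell_weight beta p)%E).
  apply: content_le_esum => // x /sub[d _ dx].
  by exists (l d) => //; exists d.
rewrite (_ : range l = \bigcup_(d in setT) [set l d]); last first.
  by apply/seteqP; split=> [_ [d _ <-]|_ [d _ ->]]; exists d.
apply: le_trans (le_esum_bigcup _ _ _) _; first exact: cell_weight_ge0.
rewrite (eq_esum (b := fun=> (weight beta k)%:E)).
  rewrite esum_fin_const ?lee_fin ?weight_ge0//.
  by rewrite card_ffun card_bool card_ord natrX.
by move=> d _; rewrite esum_set1 ?cell_weight_ge0.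
Qed.

Lemma cell_sub_cube a (r : R) k : 2 ^ (k + 1) <= r ->
  cell (k, \row_i (loc k a ord0 i + 1)) `<=` cube a r.
Proof.
move=> kr x hx i; have := hx i; rewrite /= !mxE.
have k0 : 0 < 2 ^ k :> R := pow2_gt0 k.
have := floor_itv (a ord0 i / 2 ^ k).
set v := Num.floor _; rewrite intrD ler_pdivlMr// ltr_pdivrMr//.
move: kr; rewrite pow2S; move: v%:~R => w; nra.
Qed.

Lemma le_content_cube beta a (r : R) k : 0 < beta -> beta <= n%:R ->
  2 ^ (k + 1) <= r ->
  (((4 ^+ n)^-1 * weight beta k)%:E <= H beta (cube a r))%E.
Proof.
move=> b0 bn kr; apply: le_trans (le_content _ (cell_sub_cube kr)).
by apply: le_trans (le_content_cell _ b0 bn); rewrite /cell_weight -EFinM.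
Qed.

Lemma content_cubes beta Q : 0 < beta -> beta <= n%:R -> cubes Q ->
  exists h : R, 0 < h /\ H beta Q = h%:E.
Proof.
move=> b0 bn [a [r [r0 ->]]].
have [k /andP[h1 h2]] := dyadic_scale r0.
have kr : 2 ^ (k - 2 + 1) <= r.
  by rewrite (_ : k - 2 + 1 = k - 1) ?ltW//; lia.
have lo := le_content_cube a b0 bn kr; have hi := content_cube_le a b0 h2.
have fH : H beta (cube a r) \is a fin_num.
  by rewrite ge0_fin_numE ?content_ge0// (le_lt_trans hi) ?ltry.
exists (fine (H beta (cube a r))); rewrite fineK//; split=> //.
rewrite -lte_fin fineK//; apply: lt_le_trans lo.
by rewrite lte_fin mulr_gt0 ?weight_gt0// invr_gt0 exprn_gt0.
Qed.

Lemma common_cube a (r : R) x : 0 < r -> exists a' (r' : R),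
  [/\ 0 < r', cube a r `<=` cube a' r' & cube a' r' x].
Proof.
move=> r0; pose rho := 1 + \sum_i `|x ord0 i - a ord0 i|.
have rhoP i : `|x ord0 i - a ord0 i| < rho.
  by rewrite /rho (bigD1 i)//= addrCA ltrDl ltr_pwDl// sumr_ge0.
have rho0 : 0 < rho by rewrite ltr_pwDl// sumr_ge0.
exists (\row_i (a ord0 i - rho)), (r + 2 * rho); split; first lra.
  by move=> y ay i; rewrite mxE; have := ay i; move: r0 rho0; lra.
move=> i; rewrite mxE; have := rhoP i; rewrite ltr_norml.
by move: r0 rho0; lra.
Qed.

End dyadic.

(** * Choquet integrals and sums over levels *)

Section choquet.
Context {R : realType} {n : nat}.
Local Notation H := dyadic_content.
Local Notation mu := (@lebesgue_measure R).
Implicit Types (beta : R) (D Q : set 'rV[R]_n) (f g : 'rV[R]_n -> \bar R).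

Lemma nonincreasing_emeasurable (D : set R) (u : R -> \bar R) : measurable D ->
  (forall s t : R, s <= t -> (u t <= u s)%E) -> measurable_fun D u.
Proof.
move=> mD ni; apply: (measurability _ (ErealGenOInfty.measurableE R)) => // _ [_ [x
  ->] <-].
apply: measurableI => //; apply: is_interval_measurable => s t/=.
rewrite !in_itv/= !andbT => us ut v /andP[sv vt].
by rewrite in_itv/= andbT (lt_le_trans ut)// ni.
Qed.

Definition level D f (t : R) : set 'rV[R]_n := [set x | D x /\ (t%:E < f x)%E].

Lemma le_content_level beta D f : forall s t, s <= t ->
  (H beta (level D f t) <= H beta (level D f s))%E.
Proof.
move=> s t st; apply: le_content => x [Dx tf]; split=> //.
by rewrite (le_lt_trans _ tf)// lee_fin.
Qed.

Definition slab (d : R) (j : nat) : set R := `[j%:R * d, j.+1%:R * d[%classic.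

Lemma slab_bigcup (d : R) : 0 < d -> \bigcup_j slab d j = `[0, +oo[%classic.
Proof.
move=> d0; apply/seteqP; split=> [t [j _]|t]; rewrite /slab/= !in_itv/=.
  by move=> /andP[jt _]; rewrite andbT (le_trans _ jt)// mulr_ge0// ltW.
rewrite andbT => t0; exists (Num.truncn (t / d)) => //.
rewrite /= in_itv/=; have := truncn_itv (divr_ge0 t0 (ltW d0)).
by rewrite ler_pdivlMr// ltr_pdivrMr.
Qed.

Lemma trivIset_slab (d : R) : 0 < d -> trivIset setT (slab d).
Proof.
move=> d0; have inj : forall i j : nat, (i < j)%N -> slab d i `&` slab d j = set0.
  move=> i j ij; rewrite -subset0 => t; rewrite /slab/= !in_itv/= => -[/andP[_ h1]
    /andP[h2 _]].
  have := lt_le_trans (le_lt_trans h2 h1) (ler_wpM2r (ltW d0) (_ : i.+1%:R <= j%:R)).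
  by rewrite ler_nat ij ltxx => /(_ isT).
apply/trivIsetP => i j _ _; case: (ltngtP i j) => // [/inj//|/inj].
by rewrite setIC.
Qed.

Lemma slab_measure (d : R) j : 0 < d -> mu (slab d j) = d%:E.
Proof.
move=> d0; rewrite lebesgue_measure_itv/= lte_fin ltr_pM2r// ltr_nat ltnSn.
by rewrite -EFinD -mulrBl -natrB// subSnn mul1r.
Qed.

Lemma choquet_slabs beta D f (d : R) : 0 < d ->
  choquet_int beta D f =
  (\sum_(0 <= j <oo) \int[mu]_(t in slab d j) H beta (level D f t))%E.
Proof.
move=> d0; rewrite /choquet_int -(slab_bigcup d0) ge0_integral_bigcup//.
- by move=> j; exact: measurable_itv.
- rewrite slab_bigcup//; apply: nonincreasing_emeasurable;
  first exact: measurable_itv.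
  exact: le_content_level.
- by move=> t _; exact: content_ge0.
- exact: trivIset_slab.
Qed.

(** The sum starts at level [d]: with level 0 left out, [d] times the sum is a
lower Riemann sum of the Choquet integral, and adding the content of [D] gives
an upper one. *)
Definition level_sum beta D f (d : R) : \bar R :=
  (\sum_(0 <= j <oo) H beta (level D f (j.+1%:R * d)))%E.

Lemma level_sum_ge0 beta D f d : (0 <= level_sum beta D f d)%E.
Proof. by apply: nneseries_ge0 => j _ _; exact: content_ge0. Qed.

Lemma choquet_ge beta D f (d : R) : 0 < d ->
  (d%:E * level_sum beta D f d <= choquet_int beta D f)%E.
Proof.
move=> d0; rewrite (choquet_slabs _ _ _ d0) -nneseriesZl//; last first.
  by move=> j _; exact: content_ge0.
apply: lee_nneseries => [j _ _|j _].
  by rewrite mule_ge0 ?content_ge0// lee_fin ltW.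
rewrite muleC -(slab_measure j d0) -integral_cst; last exact: measurable_itv.
apply: ge0_le_integral => //.
- exact: measurable_itv.
- by move=> t _; exact: content_ge0.
- apply: nonincreasing_emeasurable; first exact: measurable_itv.
  exact: le_content_level.
- move=> t; rewrite /slab/= in_itv/= => /andP[_ tj].
  exact: le_content_level (ltW tj).
Qed.

Lemma choquet_le beta D f (d : R) : 0 < d ->
  (choquet_int beta D f <= d%:E * (H beta D + level_sum beta D f d))%E.
Proof.
move=> d0; rewrite (choquet_slabs _ _ _ d0).
apply: (@le_trans _ _ (\sum_(0 <= j <oo) (d%:E * H beta (level D f (j%:R * d))))%E).
  apply: lee_nneseries => [j _ _|j _].
    by apply: integral_ge0 => t _; exact: content_ge0.
  rewrite [leRHS]muleC -(slab_measure j d0) -integral_cst; last exact: measurable_itv.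
  apply: ge0_le_integral => //.
  - exact: measurable_itv.
  - by move=> t _; exact: content_ge0.
  - apply: nonincreasing_emeasurable; first exact: measurable_itv.
    exact: le_content_level.
  - move=> t; rewrite /slab/= in_itv/= => /andP[tj _].
    exact: le_content_level tj.
rewrite nneseriesZl; last by move=> j _; exact: content_ge0.
rewrite lee_pmul2l ?lte_fin//.
rewrite (nneseries_split _ 1); last by move=> j _; exact: content_ge0.
rewrite add0n big_nat1; apply: leeD.
  by apply: le_content => x [].
rewrite -nneseries_addn; last by move=> j; exact: content_ge0.
by under eq_eseriesr do rewrite addn1.
Qed.

Lemma choquet_ge0 beta D f : (0 <= choquet_int beta D f)%E.
Proof. by apply: integral_ge0 => t _; exact: content_ge0. Qed.

Lemma choquet_chebyshev beta D f (d : R) : 0 < d ->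
  (d%:E * H beta (level D f d) <= choquet_int beta D f)%E.
Proof.
move=> d0; apply: le_trans (choquet_ge _ _ _ d0).
rewrite lee_pmul2l ?lte_fin//.
rewrite /level_sum (nneseries_split _ 1); last by move=> j _; exact: content_ge0.
rewrite add0n big_nat1 mul1r leeDl//.
by apply: nneseries_ge0 => j _ _; exact: content_ge0.
Qed.

Lemma le_choquet_content beta beta' D D' f (c : R) : 0 <= c -> D `<=` D' ->
  (forall E, E `<=` D -> (H beta' E <= c%:E * H beta E)%E) ->
  (choquet_int beta' D f <= c%:E * choquet_int beta D' f)%E.
Proof.
move=> c0 DD' hE; rewrite /choquet_int -ge0_integralZl_EFin//.
- apply: ge0_le_integral => //.
  + by move=> t _; exact: content_ge0.
  + apply: nonincreasing_emeasurable; first exact: measurable_itv.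
    exact: le_content_level.
  + apply: nonincreasing_emeasurable; first exact: measurable_itv.
    by move=> s t st; rewrite lee_wpmul2l ?lee_fin//; exact: le_content_level.
  + move=> t _; apply: le_trans (hE _ _) _; first by move=> x [].
    by rewrite lee_wpmul2l ?lee_fin//; apply: le_content => x [Dx tx]; split=> //;
      exact: DD'.
- by move=> t _; exact: content_ge0.
- apply: nonincreasing_emeasurable; first exact: measurable_itv.
  exact: le_content_level.
Qed.

(** Adding a constant to the integrand shifts the levels, so that the sublinearity
of the Choquet integral holds with constant 1 for constants. The number [N] is
the mesh of the levels and bounds the error of the comparison. *)
Lemma choquet_le_add beta D f g (c N : R) : 0 <= c -> 0 < N ->
  (forall x, D x -> (f x <= g x + c%:E)%E) ->
  (choquet_int beta D f <=
   choquet_int beta D g + (c + 2 * N)%:E * H beta D)%E.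
Proof.
move=> c0 N0 fg; apply: le_trans (choquet_le _ _ _ N0) _.
(* the first [M] levels are bounded by the content of [D]; above them, a level of
[f] is contained in the level of [g] that is [M] steps lower *)
pose M := (Num.truncn (c / N)).+1.
have [M1 M2] : M%:R * N <= c + N /\ c <= M%:R * N.
  have := truncn_itv (divr_ge0 c0 (ltW N0)).
  rewrite ler_pdivlMr// ltr_pdivrMr// => /andP[h1 /ltW h2]; split=> //.
  by rewrite /M -natr1 mulrDl mul1r lerD2r.
have step : (level_sum beta D f N <= M%:R%:E * H beta D + level_sum beta D g N)%E.
  rewrite /level_sum (nneseries_split _ M); last by move=> j _; exact: content_ge0.
  rewrite add0n; apply: leeD.
    apply: (@le_trans _ _ (\sum_(0 <= i < M) H beta D)%E).
      by apply: lee_sum => j _; apply: le_content => x [].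
    by rewrite sum_nat_const_ereal ?content_ge0.
  rewrite -nneseries_addn; last by move=> j; exact: content_ge0.
  apply: lee_nneseries => [j _ _|j _]; first exact: content_ge0.
  apply: le_content => x [Dx xf]; split=> //; rewrite ltNge; apply/negP => gx.
  have := lt_le_trans xf (le_trans (fg x Dx) (leeD gx (lexx c%:E))).
  rewrite -EFinD lte_fin ltNge -addSn natrD mulrDl => /negP; apply.
  by rewrite lerD2l.
apply: (@le_trans _ _ (N%:E * (H beta D + (M%:R%:E * H beta D + level_sum beta D g
  N)))%E).
  by rewrite lee_wpmul2l ?lee_fin ?(ltW N0)// leeD2l.
rewrite addeA ge0_muleDr ?level_sum_ge0//; last first.
  by rewrite adde_ge0 ?mule_ge0 ?content_ge0// lee_fin.
rewrite [leLHS]addeC; apply: leeD; first exact: choquet_ge.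
rewrite -[X in (_ * (X + _))%E]mul1e -ge0_muleDl ?lee_fin// muleA.
rewrite lee_wpmul2r ?content_ge0// -EFinD -EFinM lee_fin.
by rewrite mulrDr mulr1; lra.
Qed.

(** If [f <= s] and [g <= c - s] somewhere, then [c <= f + g] forces equality
there; up to the mesh [N], every point is in the level set of [f] at [s] or in
that of [g] at [c - s]. Summing over equally spaced [s] reduces the claim to the
subadditivity of the content for two sets, and keeps the constant 1. *)
Lemma choquet_ge_const beta D f g (c N : R) : 0 < beta -> 0 <= c -> 0 < N ->
  (forall x, D x -> (c%:E <= f x + g x)%E) ->
  (c%:E * H beta D <= choquet_int beta D f + choquet_int beta D g +
     (3 * N)%:E * H beta D)%E.
Proof.
move=> b0 c0 N0 fg.
(* the levels [j + 1] of [f] and [K - j] of [g] are paired; their sum [K + 1] has to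
remain strictly below [c / N], whence the subtraction of 2 *)
pose K := (Num.truncn (c / N) - 2)%N.
have [h1 h2] : (K.+1%:R * N < c \/ K = 0%N) /\ c <= (K%:R + 3) * N.
  have := truncn_itv (divr_ge0 c0 (ltW N0)).
  rewrite ler_pdivlMr// ltr_pdivrMr// => /andP[t1 t2]; split.
    have [K0|K0] := posnP K; [by right|left; apply: lt_le_trans t1].
    by rewrite ltr_pM2r// ltr_nat; move: K0; rewrite /K; move: (Num.truncn _) => m;
      clear; lia.
  apply: (le_trans (ltW t2)); rewrite ler_pM2r// -natrD ler_nat.
  by rewrite /K; move: (Num.truncn _) => m; clear; lia.
have step : (K%:R%:E * H beta D <= level_sum beta D f N + level_sum beta D g N)%E.
  pose u := fun j => H beta (level D f (j.+1%:R * N)).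
  pose v := fun j => H beta (level D g (j.+1%:R * N)).
  apply: (@le_trans _ _ (\sum_(0 <= j < K) u j + \sum_(0 <= j < K) v j)%E);
    last first.
    by apply: leeD; apply: nneseries_lim_ge => j _ _; exact: content_ge0.
  rewrite [X in (_ + X)%E]big_nat_rev/= -big_split/= add0n.
  apply: (@le_trans _ _ (\sum_(0 <= j < K) H beta D)%E).
    by rewrite sum_nat_const_ereal ?content_ge0.
  rewrite big_seq_cond [leRHS]big_seq_cond; apply: lee_sum => j.
  rewrite mem_index_iota/= andbT => jK.
  apply: le_contentU => // x Dx; rewrite /level/=.
  have [fx|fx] := ltP ((j.+1%:R * N)%:E) (f x); [by left|right; split=> //].
  rewrite ltNge; apply/negP => gx.
  have := le_trans (fg x Dx) (leeD fx gx).
  rewrite -EFinD lee_fin -mulrDl -natrD leNgt => /negP; apply.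
  case: h1 => [|K0]; last by rewrite K0 in jK.
  by rewrite (_ : j.+1 + (K - j.+1).+1 = K.+1)%N//; lia.
apply: (@le_trans _ _ ((K%:R * N)%:E * H beta D + (3 * N)%:E * H beta D)%E).
  rewrite -ge0_muleDl ?lee_fin ?mulr_ge0 ?(ltW N0)//.
  by rewrite lee_wpmul2r ?content_ge0// -EFinD lee_fin -mulrDl.
rewrite leeD2r//; apply: (@le_trans _ _ (N%:E * (level_sum beta D f N + level_sum
  beta D g N))%E).
  by rewrite mulrC EFinM -muleA lee_wpmul2l ?lee_fin ?(ltW N0).
by rewrite ge0_muleDr ?level_sum_ge0// leeD// choquet_ge.
Qed.

Lemma le_choquet_avg beta Q f (h s : R) : 0 < h -> H beta Q = h%:E ->
  (choquet_avg beta Q f <= s%:E)%E = (choquet_int beta Q f <= (s * h)%:E)%E.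
Proof.
move=> h0 Qh; rewrite /choquet_avg Qh inver gt_eqF// lee_pdivrMl//.
by rewrite -EFinM mulrC.
Qed.

Lemma choquet_avg_ge0 beta Q f : (0 <= choquet_avg beta Q f)%E.
Proof. by rewrite mule_ge0 ?choquet_ge0// inve_ge0 content_ge0. Qed.

Lemma choquet_avg_le_add beta Q f g (c N : R) : 0 < beta -> beta <= n%:R ->
  cubes Q -> 0 <= c -> 0 < N -> (forall x, (f x <= g x + c%:E)%E) ->
  (choquet_avg beta Q f <= choquet_avg beta Q g + (c + 2 * N)%:E)%E.
Proof.
move=> b0 bn cQ c0 N0 fg; have [h [h0 Qh]] := content_cubes b0 bn cQ.
have := @choquet_le_add beta Q f g c N c0 N0 (fun x _ => fg x).
rewrite /choquet_avg Qh inver gt_eqF//.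
move=> le1; rewrite lee_pdivrMl// ge0_muleDr; last 2 first.
- by rewrite mule_ge0 ?choquet_ge0// lee_fin invr_ge0 ltW.
- by rewrite lee_fin addr_ge0// mulr_ge0// ltW.
rewrite muleA -EFinM divff ?gt_eqF// mul1e.
by rewrite (le_trans le1)// [in leRHS]muleC.
Qed.

End choquet.

(** * Comparison of dimensions at a fixed scale *)

Section oscillation.
Context {R : realType} {n : nat}.
Variables (beta1 beta2 : R).
Hypotheses (b1 : 0 < beta1) (b12 : beta1 <= beta2) (b2n : beta2 <= n%:R).
Local Notation H := dyadic_content.
Implicit Types (a x y : 'rV[R]_n) (k : int) (p q : int * 'rV[int]_n).

Let b2 : 0 < beta2. Proof. exact: lt_le_trans b12. Qed.
Let b1n : beta1 <= n%:R. Proof. exact: le_trans b2n. Qed.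

(** The factor 3 makes [star p] contain every cube that meets [p] and is not
larger than [p]. *)
Definition star p : set 'rV[R]_n :=
  cube (\row_i (2 ^ p.1 * ((p.2 ord0 i)%:~R - 1))) (3 * 2 ^ p.1).

Lemma cubes_star p : cubes (star p).
Proof. by eexists; eexists; split; last by []; rewrite mulr_gt0// pow2_gt0. Qed.

Lemma cube_sub_star a (r : R) x k : cube a r x -> r <= 2 ^ k ->
  cube a r `<=` star (k, loc k x).
Proof.
move=> ax rk y ay i; rewrite !mxE.
have := cell_loc k x i; rewrite !mxE/=.
have /andP[] := ax i; have /andP[] := ay i.
move: (Num.floor _)%:~R => w; nra.
Qed.

Lemma cell_sub_star p : cell p `<=` star p.
Proof.
move=> x px i; have := px i; rewrite !mxE/=.
have k0 := pow2_gt0 (R := R) p.1.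
move: (_%:~R) => w; nra.
Qed.

Lemma content_star_le beta p : 0 < beta -> beta <= n%:R ->
  (H beta (star p) <= (8 ^+ n * weight beta p.1)%:E)%E.
Proof.
move=> b0 bn.
have k0 := pow2_gt0 (R := R) p.1.
have le4 : 3 * 2 ^ p.1 <= 2 ^ (p.1 + 2) :> R.
  rewrite (_ : p.1 + 2 = p.1 + 1 + 1); last by rewrite -addrA.
  by rewrite !pow2S; lra.
apply: le_trans (content_cube_le _ b0 le4) _; rewrite lee_fin.
apply: (@le_trans _ _ (2 ^+ n * (4 ^+ n * weight beta p.1))).
  by rewrite ler_wpM2l ?exprn_ge0// weightSS_le.
by rewrite (_ : 8 = 2 * 4 :> R) ?exprMn ?mulrA//; ring.
Qed.

Lemma le_content_star beta p : 0 < beta -> beta <= n%:R ->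
  (((4 ^+ n)^-1 * weight beta p.1)%:E <= H beta (star p))%E.
Proof.
move=> b0 bn; apply: le_trans (le_content _ (@cell_sub_star p)).
by apply: le_trans (le_content_cell _ b0 bn); rewrite /cell_weight -EFinM.
Qed.

Lemma weight_ratio k k' : k <= k' ->
  weight beta2 k <= weight beta2 k' / weight beta1 k' * weight beta1 k.
Proof.
move=> kk'.
have E j : weight beta2 j = weight (beta2 - beta1) j * weight beta1 j.
  by rewrite /weight -powRD ?subrK// gt_eqF ?pow2_gt0// implybT.
rewrite E [X in _ <= X / _ * _]E mulfK ?gt_eqF ?weight_gt0//.
by rewrite ler_wpM2r ?weight_ge0// le_weight// subr_ge0.
Qed.

(** If no cell of a cover is larger than [p], raising the exponent lowers its
normalised cost; if some cell is larger than [p], that cell alone costs at least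
as much, up to a constant, as a cover of [star p]. *)
Lemma content_exponent_le (E : set 'rV[R]_n) p : E `<=` star p ->
  (H beta2 E <=
   (8 ^+ n * (weight beta2 p.1 / weight beta1 p.1))%:E * H beta1 E)%E.
Proof.
move=> Ep; set C := _ * (_ / _).
have C'0 : 0 < weight beta2 p.1 / weight beta1 p.1 by rewrite divr_gt0 ?weight_gt0.
have C0 : 0 < C by rewrite mulr_gt0// exprn_gt0.
rewrite leNgt; apply/negP; rewrite -lte_pdivlMl// => /content_cover[A [EA]].
rewrite lte_pdivlMl// ltNge => /negP; apply.
have [[s As ps]|nA] := pselect (exists2 s, A s & p.1 < s.1).
  apply: (@le_trans _ _ (C%:E * cell_weight beta1 s)%E); last first.
    rewrite lee_wpmul2l ?lee_fin ?(ltW C0)//; apply: le_esum_term => //.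
    exact: cell_weight_ge0.
  apply: le_trans (le_content _ Ep) _.
  apply: le_trans (content_star_le _ b2 b2n) _.
  rewrite -EFinM lee_fin/= /C -mulrA ler_wpM2l ?exprn_ge0// mulrAC.
  rewrite ler_pdivlMr ?weight_gt0// ler_wpM2l ?weight_ge0//.
  by rewrite le_weight// ltW.
apply: le_trans (content_le_esum b2 EA) _.
apply: (@le_trans _ _ (\esum_(s in A)
    ((weight beta2 p.1 / weight beta1 p.1)%:E * cell_weight beta1 s))%E).
  apply: le_esum => s As; rewrite -EFinM lee_fin weight_ratio//.
  by rewrite leNgt; apply/negP => ps; apply: nA; exists s.
apply: le_trans (esumZl_le _ (ltW C'0) _) _; first exact: cell_weight_ge0.
rewrite lee_wpmul2r ?esum_ge0//; first by move=> s _; exact: cell_weight_ge0.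
by rewrite lee_fin /C ler_peMl ?(ltW C'0)// exprn_ege1// ler1n.
Qed.

(** * Selection of maximal heavy cells *)

(** A substitute for the Calderon-Zygmund decomposition. The weights of the
selected cells are summable because each of them is paid for by the cells of a
cover of [G] that it contains, and maximality makes these disjoint. Each point
[x] of [p] satisfies an alternative: either all the cells around [x] are light,
or the cells around [x] are light down to the parent of a selected cell. *)
Lemma calderon_zygmund beta p (G : set 'rV[R]_n) (c e : R) :
  0 < beta -> 0 < c <= 1 -> e <= 1 ->
  (H beta G < (c * e * weight beta p.1)%:E)%E ->
  exists M : set (int * 'rV[int]_n),
    (\esum_(q in M) cell_weight beta q < (e * weight beta p.1)%:E)%E /\
    let light k x := (H beta (cell (k, loc k x) `&` G) <=
                       (c * weight beta k)%:E)%E in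
    forall x, cell p x ->
      (forall k, k <= p.1 -> light k x) \/
      (exists k, [/\ k < p.1, M (k, loc k x) &
                  forall k', k < k' -> k' <= p.1 -> light k' x]).
Proof.
move=> b0 /andP[c0 c1] e1 /content_cover[A [GA sA]].
(* the weight of the part of the cover that lies inside a cell *)
pose inA q := (\esum_(s in [set s | A s /\ cell (R := R) s `<=` cell q]) cell_weight
  beta s)%E.
pose heavy q := (c%:E * cell_weight beta q <= inA q)%E.
have inA_le q : (inA q <= \esum_(s in A) cell_weight beta s)%E.
  by apply: subset_esum => [s []//|]; exact: cell_weight_ge0.
have sA' : (\esum_(s in A) cell_weight beta s < c%:E * cell_weight beta p)%E.
  apply: (lt_le_trans sA); rewrite -EFinM lee_fin ler_wpM2r ?weight_ge0//.
  by rewrite ger_pMr.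
have heavy_scale q : heavy q -> q.1 < p.1.
  move=> hq; rewrite ltNge; apply/negP => pq.
  have := lt_le_trans (le_lt_trans (le_trans hq (inA_le q)) sA') _.
  move=> /(_ (c%:E * cell_weight beta q))%E; rewrite ltxx => h.
  by apply/(notF (h _)); rewrite lee_wpmul2l ?lee_fin ?(ltW c0)// le_weight// ltW.
have heavyA s : A s -> heavy s.
  move=> As; apply: (@le_trans _ _ (cell_weight beta s)).
    by rewrite -EFinM lee_fin ger_pMl// weight_gt0.
  by apply: (@le_esum_term _ _ [set t | _ /\ _]); [exact: cell_weight_ge0|split].
have light k x : cell p x -> k <= p.1 ->
    (forall k', k <= k' -> k' <= p.1 -> ~ heavy (k', loc k' x)) ->
    (H beta (cell (k, loc k x) `&` G) <= (c * weight beta k)%:E)%E.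
  move=> px kp nh; apply: (@le_trans _ _ (inA (k, loc k x))).
    apply: content_le_esum => // y [/cellP/= yx] /GA[s As sy].
    exists s => //; split=> //; apply: (cell_nested _ sy); last exact/cellP.
    rewrite leNgt; apply/negP => /= ks.
    have /ltW sp := heavy_scale _ (heavyA s As).
    apply: (nh s.1 (ltW ks) sp).
    rewrite (_ : (s.1, _) = s); first exact: heavyA.
    move/cellP : sy => sy; rewrite [RHS]surjective_pairing -sy; congr (_, _).
    exact: loc_coarsen (ltW ks) (esym yx).
  have := nh k (lexx _) kp; rewrite /heavy => /negP; rewrite -ltNge => /ltW.
  by rewrite -EFinM.
(* the maximal heavy cells that meet [p] *)
pose M q := exists x, [/\ cell p x, q = (q.1, loc q.1 x), heavy q &
  forall k', q.1 < k' -> k' <= p.1 -> ~ heavy (k', loc k' x)].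
exists M; split.
  apply: (@le_lt_trans _ _ (\esum_(q in M) (c^-1%:E * inA q))%E).
    by apply: le_esum => q [x [_ _ hq _]]; rewrite lee_pdivlMl.
  apply: le_lt_trans (esumZl_le _ _ _) _.
  - by rewrite invr_ge0 ltW.
  - by move=> q; apply: esum_ge0 => s _; exact: cell_weight_ge0.
  rewrite lte_pdivrMl// -EFinM mulrA; apply: le_lt_trans sA.
  apply: le_esum_disjoint => [s|q s _ []//|]; first exact: cell_weight_ge0.
  have main q q' s x x' : q = (q.1, loc q.1 x) -> q' = (q'.1, loc q'.1 x') ->
      heavy q' ->
      (forall k', q.1 < k' -> k' <= p.1 -> ~ heavy (k', loc k' x)) ->
      cell (R := R) s `<=` cell q -> cell (R := R) s `<=` cell q' -> ~ q.1 < q'.1.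
    move=> -> -> hq' nh sq sq' qq'.
    apply: (nh q'.1 qq'); first exact/ltW/(heavy_scale _ hq').
    have /sq/cellP/= e1' := cell_corner (R := R) s.
    have /sq'/cellP/= e2' := cell_corner (R := R) s.
    by rewrite -(loc_coarsen (ltW qq') e1') e2'.
  move=> q q' s [x [_ qE hq nh]] [x' [_ qE' hq' nh']] [_ sq] [_ sq'].
  have /negP := main _ _ _ _ _ qE qE' hq' nh sq sq'; rewrite -leNgt => h1.
  have /negP := main _ _ _ _ _ qE' qE hq nh' sq' sq; rewrite -leNgt => h2.
  have E : q.1 = q'.1 by apply/eqP; rewrite eq_le h1 h2.
  rewrite [LHS]surjective_pairing [RHS]surjective_pairing; congr (_, _) => //.
  have /sq/cellP <- := cell_corner (R := R) s.
  by have /sq'/cellP <- := cell_corner (R := R) s; rewrite E.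
move=> /= x px.
have [nh|/existsNP[k0 /not_implyP[k0p /contrapT hk0]]] :=
    pselect (forall k, k <= p.1 -> ~ heavy (k, loc k x)).
  by left=> k kp; apply: light => // k' _; exact: nh.
right.
(* the largest heavy cell around [x] has scale [p.1 - j] with [j] minimal *)
have ex : exists j : nat, `[< heavy (p.1 - j%:Z, loc (p.1 - j%:Z) x) >].
  exists (absz (p.1 - k0)); apply/asboolP.
  by rewrite (_ : p.1 - (absz (p.1 - k0))%:Z = k0)//; move: k0p; clear; lia.
case: (ex_minnP ex) => j /asboolP hj jmin.
have nh k' : p.1 - j%:Z < k' -> k' <= p.1 -> ~ heavy (k', loc k' x).
  move=> jk kp hk.
  have : (j <= absz (p.1 - k'))%N.
    apply: jmin; apply/asboolP.
    by rewrite (_ : p.1 - (absz (p.1 - k'))%:Z = k')//; move: kp; clear; lia.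
  by move: jk kp; clear; lia.
have jp := heavy_scale _ hj.
exists (p.1 - j%:Z); split=> //; first by exists x.
move=> k' jk kp; apply: light => // k'' kk; apply: nh; exact: lt_le_trans kk.
Qed.

(** * Exponential decay of the oscillation *)

Definition deviation (f : 'rV[R]_n -> R) (c : R) x : \bar R := `|f x - c|%:E.

Section centers.
Variables (f : 'rV[R]_n -> R) (N : R) (m : int * 'rV[int]_n -> R).
Hypothesis N0 : 0 < N.
Hypothesis mP : forall p, (choquet_int beta1 (star p) (deviation f (m p)) <=
  (N * (8 ^+ n * weight beta1 p.1))%:E)%E.

Lemma star_integral_exponent p (P : set 'rV[R]_n) : P `<=` star p ->
  (choquet_int beta2 P (deviation f (m p)) <= ((4 ^+ n) ^+ 3 * N * weight beta2
    p.1)%:E)%E.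
Proof.
move=> Pp; set C := 8 ^+ n * (weight beta2 p.1 / weight beta1 p.1).
have C0 : 0 <= C.
  by rewrite mulr_ge0 ?exprn_ge0// divr_ge0 ?weight_ge0.
apply: le_trans (le_choquet_content _ C0 Pp _) _.
  move=> E EP; apply: content_exponent_le; exact: subset_trans EP Pp.
apply: (@le_trans _ _ (C%:E * (N * (8 ^+ n * weight beta1 p.1))%:E)%E).
  by rewrite lee_wpmul2l ?lee_fin.
rewrite -EFinM lee_fin /C (_ : _ * (N * _) = (8 ^+ n) ^+ 2 * N * weight beta2 p.1).
  rewrite ler_wpM2r ?weight_ge0// ler_wpM2r ?(ltW N0)//.
  rewrite -!exprM -![(n * _)%N]mulnC !exprM.
  by rewrite lerXn2r ?nnegrE ?exprn_ge0//; lra.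
by field; rewrite gt_eqF ?weight_gt0.
Qed.

Lemma avg_at_scale a (r : R) x k : cube a r x -> 2 ^ (k - 1) < r <= 2 ^ k ->
  (choquet_avg beta2 (cube a r) (deviation f (m (k, loc k x))) <= ((4 ^+ n) ^+ 5 *
    N)%:E)%E.
Proof.
move=> ax /andP[kr rk].
have r0 : 0 < r by apply: lt_trans kr; exact: pow2_gt0.
have cP : cubes (cube a r) by exists a, r.
have [h [h0 Ph]] := content_cubes b2 b2n cP.
rewrite (le_choquet_avg _ _ h0 Ph).
apply: le_trans (star_integral_exponent (cube_sub_star ax rk)) _.
rewrite lee_fin/=.
have lo : (4 ^+ n)^-1 * weight beta2 (k - 2) <= h.
  rewrite -lee_fin -Ph; apply: le_content_cube => //.
  by rewrite (_ : k - 2 + 1 = k - 1) ?ltW//; clear; lia.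
have hk : weight beta2 k <= (4 ^+ n) ^+ 2 * h.
  rewrite -[X in weight _ X](subrK 2 k); apply: le_trans (weightSS_le _ b2n) _.
  by rewrite expr2 -mulrA ler_wpM2l ?exprn_ge0// -ler_pdivrMl// exprn_gt0.
rewrite (_ : _ * h = (4 ^+ n) ^+ 3 * N * ((4 ^+ n) ^+ 2 * h)); last by ring.
by rewrite ler_wpM2l// mulr_ge0 ?exprn_ge0// ltW.
Qed.

Lemma avg_change_center (P : set 'rV[R]_n) (c c' : R) : cubes P ->
  (choquet_avg beta2 P (deviation f c) <=
   choquet_avg beta2 P (deviation f c') + (`|c - c'| + 2 * N)%:E)%E.
Proof.
move=> cP; apply: choquet_avg_le_add => // x.
rewrite /deviation -EFinD lee_fin (_ : f x - c = f x - c' - (c - c')); last by ring.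
exact: ler_normB.
Qed.

Lemma center_le_maximal q y : star q y ->
  (`|m q|%:E <= maximal beta2 f y + (((4 ^+ n) ^+ 5 + 3) * N)%:E)%E.
Proof.
move=> qy; have [h [h0 qh]] := content_cubes b2 b2n (cubes_star q).
have avg_le : (choquet_avg beta2 (star q) (fun y => `|f y|%:E) <= maximal beta2 f
  y)%E.
  by apply: ereal_sup_ubound; exists (star q) => //; split=> //; exact: cubes_star.
case E : (maximal beta2 f y) avg_le => [s||] avg_le.
- rewrite (le_choquet_avg _ _ h0 qh) in avg_le.
  have := @choquet_ge_const _ _ beta2 (star q) (fun y => `|f y|%:E)
    (deviation f (m q)) `|m q| N b2 (normr_ge0 _) N0.
  have tri x : star q x -> (`|m q|%:E <= `|f x|%:E + deviation f (m q) x)%E.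
    move=> _; rewrite /deviation -EFinD lee_fin.
    by rewrite -{1}(subKr (f x) (m q)) (le_trans (ler_normB _ _)).
  move=> /(_ tri) main.
  have up := le_trans main (leeD (leeD avg_le (star_integral_exponent (@subset_refl _
    (star q)))) (lexx _)).
  rewrite qh -!EFinM -!EFinD lee_fin in up.
  rewrite -EFinD lee_fin -(ler_pM2r h0); apply: (le_trans up).
  have lo : (4 ^+ n)^-1 * weight beta2 q.1 <= h.
    by rewrite -lee_fin -qh; exact: le_content_star.
  have hk : weight beta2 q.1 <= (4 ^+ n) ^+ 2 * h.
    apply: (@le_trans _ _ (4 ^+ n * h)).
      by rewrite -ler_pdivrMl// exprn_gt0.
    by rewrite ler_wpM2r ?(ltW h0)// expr2 ler_peMl ?exprn_ge0// exprn_ege1// ler1n.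
  rewrite [leRHS]mulrDl -addrA lerD2l [in leRHS]mulrDl [leRHS]mulrDl lerD2r.
    rewrite (_ : _ * N * h = (4 ^+ n) ^+ 3 * N * ((4 ^+ n) ^+ 2 * h)); last by ring.
  by rewrite ler_wpM2l// mulr_ge0 ?exprn_ge0// ltW.
- by rewrite addye// leey.
- have := le_trans (choquet_avg_ge0 _ _ _) avg_le; by rewrite leeNy_eq.
Qed.

(** With [c = (4 ^+ n)^-1] the constant of [le_content_cell], this is
[c ^+ 2 / 16]. It has to be so small that the points far from the centre of a
cell or from that of its parent do not fill the cell, although the weight of the
parent may be [2 ^+ n] times that of the cell, and that the selection at
heaviness [c / 4] halves the weight. *)
Definition far_fraction : R := (16 * (4 ^+ n) ^+ 2)^-1.

(** Chebyshev's inequality turns this level into the fraction [far_fraction]. *)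
Definition far_threshold : R := N * 8 ^+ n / far_fraction.

Lemma far_fraction_gt0 : 0 < far_fraction.
Proof. by rewrite invr_gt0 mulr_gt0// exprn_gt0. Qed.

Lemma far_threshold_gt0 : 0 < far_threshold.
Proof. by rewrite divr_gt0 ?far_fraction_gt0// mulr_gt0// exprn_gt0. Qed.

Lemma content_far p (D : set 'rV[R]_n) : D `<=` star p ->
  (H beta1 (level D (deviation f (m p)) far_threshold) <= (far_fraction * weight
    beta1 p.1)%:E)%E.
Proof.
move=> Dp; apply: (@le_trans _ _ (H beta1 (level (star p) (deviation f (m p))
  far_threshold))).
  by apply: le_content => x [/Dp].
have := le_trans (choquet_chebyshev beta1 (star p) (deviation f (m p))
  far_threshold_gt0) (mP p).
rewrite -lee_pdivlMl ?far_threshold_gt0// => /le_trans; apply.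
rewrite -EFinM lee_fin le_eqVlt; apply/orP; left; apply/eqP.
by rewrite /far_threshold; field; rewrite ?gt_eqF ?far_fraction_gt0 ?exprn_gt0.
Qed.

(** The points of the cell that are far from one of the two centres do not fill
the cell, so some point is close to both. *)
Lemma centers_close k x q' (e : R) :
  e + far_fraction < (4 ^+ n)^-1 ->
  (H beta1 (level (cell (k, loc k x)) (deviation f (m q')) far_threshold) <=
     (e * weight beta1 k)%:E)%E ->
  `|m (k, loc k x) - m q'| <= 2 * far_threshold.
Proof.
move=> e1 hq'; set q := (k, loc k x); rewrite leNgt; apply/negP => far.
have sub : cell q `<=` level (cell q) (deviation f (m q')) far_threshold `|`
    level (cell q) (deviation f (m q)) far_threshold.
  move=> y qy; rewrite /level/deviation/= !lte_fin.
  have [h1|h1] := ltP far_threshold `|f y - m q'|; first by left.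
  right; split=> //; rewrite ltNge; apply/negP => h2.
  move: far; rewrite ltNge => /negP; apply.
  rewrite (_ : m q - m q' = (f y - m q') - (f y - m q)); last by ring.
  by apply: le_trans (ler_normB _ _) _; lra.
have := le_contentU b1 sub.
move=> /le_trans/(_ (leeD hq' (content_far (@cell_sub_star q)))).
move=> /(le_trans (le_content_cell q b1 b1n)).
rewrite -EFinM -EFinD lee_fin -mulrDl ler_pM2r ?weight_gt0//.
by rewrite leNgt e1.
Qed.

Let cell_const : R := (4 ^+ n)^-1.

Let cell_const_gt0 : 0 < cell_const. Proof. by rewrite invr_gt0 exprn_gt0. Qed.
Let cell_const_le1 : cell_const <= 1.
Proof. by rewrite invf_le1 ?exprn_gt0// exprn_ege1// ler1n. Qed.
Let far_fractionE : far_fraction = cell_const ^+ 2 / 16.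
Proof.
by rewrite /far_fraction /cell_const; field; rewrite expf_neq0.
Qed.
Let far_fraction_small : 2 ^+ n * far_fraction <= cell_const / 16.
Proof.
rewrite far_fractionE expr2 mulrA ler_pM2r; last by rewrite invr_gt0.
rewrite mulrA ger_pMl// /cell_const ler_pdivrMr ?exprn_gt0// mul1r.
by rewrite lerXn2r ?nnegrE// ler_nat.
Qed.

Lemma parent_close k x :
  `|m (k, loc k x) - m (k + 1, loc (k + 1) x)| <= 2 * far_threshold.
Proof.
apply: (@centers_close _ _ _ (2 ^+ n * far_fraction)).
  rewrite -/cell_const; apply: (@le_lt_trans _ _ (cell_const / 8));
    last by have := cell_const_gt0; lra.
  have := far_fraction_small; have : far_fraction <= cell_const / 16; last by lra.
  by rewrite far_fractionE expr2 -mulrA ger_pMl ?divr_gt0.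
set q := (k, _); set q' := (k + 1, _).
have qq' : cell q `<=` star q'.
  apply: subset_trans (@cell_sub_star q'); apply: (cell_nested _ (cell_loc k x)
    (cell_loc _ x)) => /=.
  by rewrite lerDl.
apply: le_trans (content_far qq') _.
rewrite lee_fin mulrC mulrAC ler_wpM2r ?(ltW far_fraction_gt0)//.
exact: weightS_le.
Qed.

Definition tail_set p (lam : R) : set 'rV[R]_n :=
  [set x | cell p x /\ exists a r, [/\ 0 < r, r <= 2 ^ p.1, cube a r x &
     (lam%:E < choquet_avg beta2 (cube a r) (deviation f (m p)))%E]].

(** The centre of a selected cell is at distance at most [4 * far_threshold] from
that of [p], which bounds the loss in one selection; the second summand absorbs
the bounds of [avg_at_scale] and [center_le_maximal] and the errors due to the
mesh [N]. *)
Definition decay_step : R := 4 * far_threshold + (2 * (4 ^+ n) ^+ 5 + 5) * N.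

Let K0 : 0 <= (4 ^+ n) ^+ 5 :> R. Proof. by do 2 apply: exprn_ge0. Qed.

Lemma decay_step_gt0 : 0 < decay_step.
Proof.
apply: addr_gt0; first by rewrite mulr_gt0 ?far_threshold_gt0.
by rewrite mulr_gt0//; have := K0; lra.
Qed.

(** The alternative in the hypothesis is the one that [calderon_zygmund]
provides. Let [P] be a cube around [x] with a large average, and [k] its scale.
If the cell of scale [k] around [x] is light, its centre is close to that of
[p], and the average over [P] cannot be large. So [k] is at most the scale of a
selected cell, and passing to the centre of that cell costs at most
[decay_step]. *)
Lemma tail_set_step p (lam : R) (M : set (int * 'rV[int]_n)) : 0 <= lam ->
  (forall x, cell p x ->
    let light k x := (H beta1 (cell (k, loc k x) `&`
       level (cell p) (deviation f (m p)) far_threshold) <= (cell_const / 4 * weight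
         beta1 k)%:E)%E in
    (forall k, k <= p.1 -> light k x) \/
    (exists k, [/\ k < p.1, M (k, loc k x) &
                  forall k', k < k' -> k' <= p.1 -> light k' x])) ->
  tail_set p (lam + decay_step) `<=` \bigcup_(q in M) tail_set q lam.
Proof.
move=> lam0 HM x [px [a [r [r0 rp ax avg]]]].
have cP : cubes (cube a r) by exists a, r.
have [k /andP[kr rk]] := dyadic_scale r0.
have kp : k <= p.1.
  have : k - 1 < p.1.
    by rewrite -(ltr_eXz2l (x := 2 : R)) ?ltr1n//; exact: lt_le_trans kr rp.
  by clear; lia.
have near k' : k' <= p.1 -> (H beta1 (cell (k', loc k' x) `&`
       level (cell p) (deviation f (m p)) far_threshold) <= (cell_const / 4 * weight
         beta1 k')%:E)%E ->
    `|m (k', loc k' x) - m p| <= 2 * far_threshold.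
  move=> kp' light; apply: (@centers_close _ _ _ (cell_const / 4)).
    have := cell_const_gt0; have := far_fraction_small.
    have : far_fraction <= 2 ^+ n * far_fraction by rewrite ler_peMl ?(ltW
      far_fraction_gt0)// exprn_ege1// ler1n.
    by rewrite -/cell_const; lra.
  apply: le_trans light; apply: le_content => y [qy fy]; split=> //; split=> //.
  by apply: (cell_nested _ (cell_loc k' x) px) qy.
have [t0 N1] : 0 <= far_threshold /\ 0 <= N by split; rewrite ltW// far_threshold_gt0.
(* a light cell of the scale of the cube contradicts the large average *)
have small : `|m (k, loc k x) - m p| <= 2 * far_threshold -> False.
  move=> close; have := lt_le_trans avg (avg_change_center (m p) (m (k, loc k x)) cP).
  have h1 : (2 ^ (k - 1) < r <= 2 ^ k) by rewrite kr.
  move=> /lt_le_trans/(_ (leeD (avg_at_scale ax h1) (lexx _))).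
  rewrite -EFinD lte_fin distrC /decay_step ltNge => /negP; apply.
  have := mulr_ge0 K0 N1; move: close lam0 t0 N1; lra.
case: (HM x px) => [light|[kM [kMp MkM light]]].
  by exfalso; apply: small; apply: near => //; exact: light.
have [kMk|kkM] := ltP kM k.
  by exfalso; apply: small; apply: near => //; exact: light.
exists (kM, loc kM x) => //; split; first exact: cell_loc.
exists a, r; split; [exact: r0| |exact: ax|].
  by apply: le_trans rk _; exact: le_pow2.
rewrite ltNge; apply/negP => avg'.
have := lt_le_trans avg (avg_change_center (m p) (m (kM, loc kM x)) cP).
move=> /lt_le_trans/(_ (leeD avg' (lexx _))).
rewrite -EFinD lte_fin /decay_step ltNge => /negP; apply.
(* from the selected cell to its parent, which is light, and then to [p] *)
have c1 := parent_close kM x.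
have c2 : `|m (kM + 1, loc (kM + 1) x) - m p| <= 2 * far_threshold.
  have hk : kM + 1 <= p.1 by move: kMp; clear; lia.
  by apply: near => //; apply: light => //; clear; lia.
have := ler_distD (m (kM + 1, loc (kM + 1) x)) (m p) (m (kM, loc kM x)).
rewrite [`|m p - m (kM + 1, _)|]distrC [`|m (kM + 1, _) - m (kM, _)|]distrC.
have := mulr_ge0 K0 N1; move: c1 c2 lam0 t0 N1; lra.
Qed.

Lemma tail_set_decay p (j : nat) :
  (H beta1 (tail_set p (j%:R * decay_step)) < (2 * 2^-1 ^+ j * weight beta1
    p.1)%:E)%E.
Proof.
elim: j p => [|j IH] p.
  apply: (@le_lt_trans _ _ (cell_weight beta1 p)).
    apply: le_trans (content_cell_le p b1); apply: le_content => x [//].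
  by rewrite lte_fin expr0 mulr1 ltr_pMl ?weight_gt0// ltr1n.
have [] := @calderon_zygmund beta1 p (level (cell p) (deviation f (m p))
  far_threshold) (cell_const / 4) 2^-1 b1.
- by rewrite divr_gt0//=; have := cell_const_le1; lra.
- by rewrite invf_le1// ler1n.
- apply: le_lt_trans (content_far (@cell_sub_star p)) _.
  rewrite lte_fin ltr_pM2r ?weight_gt0//.
  have := far_fraction_small; have := cell_const_gt0.
  have : far_fraction <= 2 ^+ n * far_fraction by rewrite ler_peMl ?(ltW
    far_fraction_gt0)// exprn_ege1// ler1n.
  by lra.
move=> M [sM HM].
have jj : j.+1%:R * decay_step = j%:R * decay_step + decay_step by rewrite -natr1
  mulrDl mul1r.
rewrite jj; have lam0 : 0 <= j%:R * decay_step by rewrite mulr_ge0// ltW//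
  decay_step_gt0.
apply: le_lt_trans (le_content _ (tail_set_step lam0 HM)) _.
apply: le_lt_trans (content_bigcup_lt (s := fun q => (2 * 2^-1 ^+ j)%:E * cell_weight
  beta1 q)%E b1 _) _.
  by move=> q _; rewrite -EFinM; exact: IH.
have c0 : 0 < 2 * 2^-1 ^+ j :> R by rewrite mulr_gt0// exprn_gt0// invr_gt0.
apply: le_lt_trans (esumZl_le _ (ltW c0) _) _; first exact: cell_weight_ge0.
rewrite -lte_pdivlMl// ; apply: lt_le_trans sM _.
rewrite -EFinM lee_fin exprS le_eqVlt; apply/orP; left; apply/eqP.
by field; rewrite expf_neq0// invr_neq0.
Qed.

(** A cube around [x] larger than the cube under consideration is comparable to a
star that contains [y], hence its average is controlled by the maximal function
at [y]; only the smaller cubes can make the maximal function at [x] much larger,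
and these put [x] in a tail set. *)
Lemma maximal_tail a (r : R) k y (s : R) (j : nat) :
  0 < r -> r <= 2 ^ k -> cube a r y -> (maximal beta2 f y <= s%:E)%E ->
  (H beta1 [set x | cube a r x /\
      ((s + decay_step + j%:R * decay_step)%:E < maximal beta2 f x)%E]
    <= (2 ^+ n * (2 * 2^-1 ^+ j * weight beta1 k))%:E)%E.
Proof.
move=> r0 rk ay fy.
have lam0 : 0 <= j%:R * decay_step by rewrite mulr_ge0// ltW// decay_step_gt0.
have [t0 N1] : 0 <= far_threshold /\ 0 <= N by split; rewrite ltW// far_threshold_gt0.
have KN := mulr_ge0 K0 N1.
have ctr q : star q y -> `|m q| <= s + ((4 ^+ n) ^+ 5 + 3) * N.
  move=> qy; rewrite -lee_fin EFinD; apply: le_trans (center_le_maximal qy) _.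
  by rewrite leeD2r.
have avg0 (P : set 'rV[R]_n) c : cubes P -> (choquet_avg beta2 P (fun x => `|f x|%:E)
  <=
    choquet_avg beta2 P (deviation f c) + (`|c| + 2 * N)%:E)%E.
  move=> cP; apply: choquet_avg_le_add => // x.
  by rewrite /deviation -EFinD lee_fin -{1}(subrK c (f x)) ler_normD.
apply: le_trans (content_finite_union (T := {ffun 'I_n -> bool})
  (E := fun d => tail_set (k, loc k a + \row_i (d i)%:Z) (j%:R * decay_step))
  (s := 2 * 2^-1 ^+ j * weight beta1 k) b1 _ _ _) _.
- by rewrite mulr_ge0 ?weight_ge0// mulr_ge0// exprn_ge0// invr_ge0.
- move=> x [ax]; rewrite /maximal => /ereal_sup_gt[_ [P [[a' [r' [r'0 ->]]] Px] <-]
  avg].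
  have cP : cubes (cube a' r') by exists a', r'.
  suff tx : tail_set (k, loc k x) (j%:R * decay_step) x.
    have [d _ dx] := sub_cube_cells rk ax; exists d; first by [].
    by move/cellP : dx => /= <-.
  split; first exact: cell_loc.
  have xk : star (k, loc k x) y by apply: (cube_sub_star ax rk).
  have [r'k|kr'] := leP r' (2 ^ k).
    exists a', r'; split; [exact: r'0|exact: r'k|exact: Px|].
    rewrite ltNge; apply/negP => avg'.
    have := lt_le_trans avg (avg0 _ (m (k, loc k x)) cP).
    move=> /lt_le_trans/(_ (leeD avg' (lexx _))).
    rewrite -EFinD lte_fin /= ltNge => /negP; apply.
    by have := ctr _ xk; rewrite /decay_step; move: KN N1 t0 lam0; lra.
  exfalso.
  have [k' /andP[k'r' r'k']] := dyadic_scale r'0.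
  have kk' : r <= 2 ^ k'.
    by apply: (le_trans rk); apply: le_trans (ltW kr') r'k'.
  have xk' : star (k', loc k' x) y by apply: (cube_sub_star ax kk').
  have h1 : (2 ^ (k' - 1) < r' <= 2 ^ k') by rewrite k'r'.
  have := lt_le_trans avg (avg0 _ (m (k', loc k' x)) cP).
  move=> /lt_le_trans/(_ (leeD (avg_at_scale Px h1) (lexx _))).
  rewrite -EFinD lte_fin ltNge => /negP; apply.
  have jE : decay_step = 4 * far_threshold + (2 * (4 ^+ n) ^+ 5 + 5) * N by [].
  by have := ctr _ xk'; move: jE KN N1 t0 lam0; lra.
- by move=> d; exact: tail_set_decay.
by rewrite card_ffun card_bool card_ord natrX.
Qed.

End centers.

(** * Lower oscillation of the maximal function *)

Section bounds.
Variables (f : 'rV[R]_n -> R) (N : R).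
Hypothesis N0 : 0 < N.
Hypothesis fN : (bmo_norm beta1 f < N%:E)%E.

Lemma bmo_centers : exists m : int * 'rV[int]_n -> R, forall p,
  (choquet_int beta1 (star p) (deviation f (m p)) <=
   (N * (8 ^+ n * weight beta1 p.1))%:E)%E.
Proof.
suff : forall p, exists c : R, (choquet_int beta1 (star p) (deviation f c) <=
   (N * (8 ^+ n * weight beta1 p.1))%:E)%E.
  by move=> /choice[m mP]; exists m.
move=> p; have cp := cubes_star p.
have : (ereal_inf (range (fun c : R => choquet_avg beta1 (star p) (deviation f c))) <
  N%:E)%E.
  by apply: le_lt_trans fN; apply: ereal_sup_ubound; exists (star p).
move=> /ereal_inf_lt[_ [c _ <-]] /ltW cN; exists c.
have [h [h0 ph]] := content_cubes b1 b1n cp.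
move: cN; rewrite (le_choquet_avg _ _ h0 ph) => /le_trans; apply.
rewrite lee_fin ler_wpM2l ?(ltW N0)// -lee_fin -ph.
exact: content_star_le.
Qed.

Lemma maximal_bmo_tail a (r : R) k y (s : R) (j : nat) :
  0 < r -> r <= 2 ^ k -> cube a r y -> (maximal beta2 f y <= s%:E)%E ->
  (H beta1 [set x | cube a r x /\
      ((s + decay_step N + j%:R * decay_step N)%:E < maximal beta2 f x)%E]
    <= (2 ^+ n * (2 * 2^-1 ^+ j * weight beta1 k))%:E)%E.
Proof.
have [m mP] := bmo_centers; exact: (maximal_tail N0 mP).
Qed.

Lemma maximal_ge0 x : (0 <= maximal beta2 f x)%E.
Proof.
apply: (@le_trans _ _ (choquet_avg beta2 (cube (\row_i (x ord0 i - 1)) 2)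
  (fun y => `|f y|%:E))); first exact: choquet_avg_ge0.
apply: ereal_sup_ubound; exists (cube (\row_i (x ord0 i - 1)) 2) => //; split.
  by eexists; eexists; split; last reflexivity.
by move=> i; rewrite !mxE; lra.
Qed.

Let Mf := maximal beta2 f.

Lemma ess_inf_maximal_ge0 (Q : set 'rV[R]_n) :
  (0 <= ess_inf_content beta1 Q Mf)%E.
Proof.
apply: ereal_sup_ubound; exists 0 => //=.
rewrite (_ : [set x | _] = set0) ?content0//.
rewrite -subset0 => x [_]; rewrite ltNge => /negP; apply; exact: maximal_ge0.
Qed.

(** An infinite essential infimum would make the maximal function exceed every
bound at almost all points of the cube, while in a cube that also contains [x0]
the tails starting from the value at [x0] have content tending to 0. *)
Lemma ess_inf_maximal_fin a (r : R) x0 : 0 < r -> (Mf x0 < +oo)%E ->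
  exists e : R, ess_inf_content beta1 (cube a r) Mf = e%:E.
Proof.
move=> r0 fx0; have ge0 := ess_inf_maximal_ge0 (cube a r).
case E : (ess_inf_content beta1 (cube a r) Mf) ge0 => [e||]// _; first by exists e.
exfalso.
have [s sE] : exists s : R, Mf x0 = s%:E.
  by case: (Mf x0) (maximal_ge0 x0 : (0 <= Mf x0)%E) fx0 => [s||]//; exists s.
have [a' [r' [r'0 QQ' x0Q']]] := common_cube a x0 r0.
have [k /andP[_ r'k]] := dyadic_scale r'0.
have cQ : cubes (cube a r) by exists a, r.
have [h [h0 Qh]] := content_cubes b1 b1n cQ.
have [j hj] := exp2_unbounded (2 ^+ n * (2 * weight beta1 k) / h).
have [_ [c hc <-] cB] : exists2 z, [set c%:E | c in [set c : R |
      H beta1 [set x | cube a r x /\ (Mf x < c%:E)%E] = 0%E]] z &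
    ((s + decay_step N + j%:R * decay_step N)%:E < z)%E.
  by apply: ereal_sup_gt; rewrite -/(ess_inf_content _ _ _) E ltry.
have sub : cube a r `<=` [set x | cube a r x /\ (Mf x < c%:E)%E] `|`
    [set x | cube a' r' x /\ ((s + decay_step N + j%:R * decay_step N)%:E < Mf x)%E].
  move=> x Qx; have [h1|h1] := ltP (Mf x) c%:E; [by left|right; split].
    exact: QQ'.
  exact: lt_le_trans cB h1.
have := le_contentU b1 sub; rewrite hc add0e Qh.
move=> /le_trans/(_ (maximal_bmo_tail _ r'0 r'k x0Q' _)).
rewrite -/Mf sE lexx => /(_ isT); rewrite lee_fin leNgt => /negP; apply.
move: hj; rewrite ltr_pdivrMr// => hj.
rewrite (_ : _ * _ = 2 ^+ n * (2 * weight beta1 k) / 2 ^+ j).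
  by rewrite ltr_pdivrMr ?exprn_gt0// [h * _]mulrC.
by rewrite exprVn; field; rewrite expf_neq0.
Qed.

Lemma decay_step_ge : N <= decay_step N.
Proof.
have t0 : 0 <= far_threshold N by rewrite ltW// far_threshold_gt0.
have K0 : 0 <= ((4 ^+ n) ^+ 5) * N by rewrite mulr_ge0 ?(ltW N0)// !exprn_ge0.
by rewrite /decay_step; move: t0 K0 (ltW N0); lra.
Qed.

(** The terms of the level sum, with mesh [decay_step], at levels 0 and 1 give 2;
those at higher levels form a geometric series, and [2 ^+ n * (4 ^+ n) ^+ 2]
compares the cells of the scale of a cube with the cube. *)
Definition blo_const : R := 2 + 4 * (2 ^+ n * (4 ^+ n) ^+ 2).

Lemma blo_maximal_le x0 : (Mf x0 < +oo)%E ->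
  (blo_norm beta1 Mf <= (decay_step N * blo_const)%:E)%E.
Proof.
move=> fx0; apply: ge_ereal_sup => _ [Q cQ <-].
have [h [h0 Qh]] := content_cubes b1 b1n cQ.
rewrite (le_choquet_avg _ _ h0 Qh).
case: cQ Qh => a [r [r0 ->]] Qh.
have [e eE] := ess_inf_maximal_fin a r0 fx0.
have [k /andP[kr rk]] := dyadic_scale r0.
have J0 : 0 < decay_step N by exact: lt_le_trans decay_step_ge.
(* otherwise [e + N] would be a larger essential lower bound *)
have [y Qy fy] : exists2 y, cube a r y & (Mf y <= (e + N)%:E)%E.
  apply: contrapT => nex.
  have : ((e + N)%:E <= ess_inf_content beta1 (cube a r) Mf)%E.
    apply: ereal_sup_ubound; exists (e + N) => //=.
    rewrite (_ : [set x | _] = set0) ?content0//.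
    by rewrite -subset0 => x [Qx /ltW fx]; apply: nex; exists x.
  by rewrite eE lee_fin; move: N0; lra.
apply: le_trans (choquet_le _ _ _ J0) _.
have hk : weight beta1 k <= (4 ^+ n) ^+ 2 * h.
  rewrite -[X in weight _ X](subrK 2 k); apply: le_trans (weightSS_le _ b1n) _.
  rewrite expr2 -mulrA ler_wpM2l ?exprn_ge0// -ler_pdivrMl ?exprn_gt0//.
  rewrite -lee_fin -Qh; apply: le_content_cube => //.
  by rewrite (_ : k - 2 + 1 = k - 1) ?ltW//; clear; lia.
pose W := 2 ^+ n * weight beta1 k.
have W0 : 0 <= W by rewrite mulr_ge0 ?weight_ge0// exprn_ge0.
have lev : (level_sum beta1 (cube a r)
    (fun x => Mf x - ess_inf_content beta1 (cube a r) Mf)%dE (decay_step N) <=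
    (h + 4 * W)%:E)%E.
  rewrite /level_sum (nneseries_split _ 1); last by move=> j _; exact: content_ge0.
  rewrite add0n big_nat1 EFinD; apply: leeD.
    by rewrite -Qh; apply: le_content => x [].
  rewrite -nneseries_addn; last by move=> j; exact: content_ge0.
  apply: le_trans (epsilon_trick0 xpredT _); last by rewrite mulr_ge0.
  apply: lee_nneseries => [j _ _|j _]; first exact: content_ge0.
  have := maximal_bmo_tail j r0 rk Qy fy.
  rewrite (_ : _ * (2 * _ * _) = 4 * W / (2 ^ j.+1)%:R); last first.
    by rewrite /W exprVn natrX exprS; field; rewrite expf_neq0.
  apply: le_trans; apply: le_content => x [Qx]; rewrite eE => lt1; split=> //.
  rewrite -/Mf; case: (Mf x) lt1 => [s| |]; [|by move=> _; rewrite ltry|by []].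
  rewrite (_ : (s%:E - e%:E)%dE = (s - e)%:E)// !lte_fin addn1 -!natr1 !mulrDl mul1r.
  by move: decay_step_ge; lra.
rewrite Qh; apply: (@le_trans _ _ ((decay_step N)%:E * (h%:E + (h + 4 * W)%:E))%E).
  by rewrite lee_wpmul2l ?lee_fin ?(ltW J0)// leeD2l.
rewrite -EFinD -EFinM lee_fin -mulrA ler_wpM2l ?(ltW J0)// /blo_const /W.
have : 2 ^+ n * weight beta1 k <= 2 ^+ n * ((4 ^+ n) ^+ 2 * h).
  by rewrite ler_wpM2l ?exprn_ge0.
by lra.
Qed.

End bounds.

End oscillation.

Lemma decay_stepE (R : realType) (n : nat) (N : R) : @decay_step R n N = @decay_step
  R n 1 * N.
Proof. by rewrite /decay_step /far_threshold; ring. Qed.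

Theorem theorem5p3 (R : realType) (n : nat) (beta1 beta2 : R)
    (hbeta1 : 0 < beta1) (hbeta12 : beta1 <= beta2) (hbeta2 : beta2 <= n%:R) :
  exists C : R, 0 < C /\
    forall f : 'rV[R]_n -> R,
      in_bmo beta1 f ->
      ~ (forall x : 'rV[R]_n, maximal beta2 f x = +oo%E) ->
      (blo_norm beta1 (maximal beta2 f) <= C%:E * bmo_norm beta1 f)%E.
Proof.
have C0 : 0 < @decay_step R n 1 * @blo_const R n :> R.
  rewrite mulr_gt0 ?decay_step_gt0// /blo_const ltr_pwDl// mulr_ge0// mulr_ge0//.
exists (@decay_step R n 1 * @blo_const R n); split=> // f [_ _ fin] /existsNP[x0 /eqP
  fx0].
have fx0' : (maximal beta2 f x0 < +oo)%E by rewrite lt_neqAle fx0 leey.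
have bmo0 : (0 <= bmo_norm beta1 f)%E.
  pose Q : set 'rV[R]_n := cube 0 1.
  apply: (@le_trans _ _ (ereal_inf
      (range (fun c : R => choquet_avg beta1 Q (fun x => `|f x - c|%:E))))).
    by apply: le_ereal_inf_tmp => _ [c _ <-]; exact: choquet_avg_ge0.
  by apply: ereal_sup_ubound; exists Q => //; exists 0, 1.
have [b bE] : exists b : R, bmo_norm beta1 f = b%:E.
  by case: (bmo_norm beta1 f) bmo0 fin => [b||]//; exists b.
rewrite bE lee_fin in bmo0; rewrite bE -EFinM; apply/lee_addgt0Pr => e e0.
set C := @decay_step R n 1 * _ in C0 *.
(* the norm may vanish, whereas the estimate needs a positive bound; it is applied
with the norm increased by [e / C] *)
have eC : 0 < e / C by rewrite divr_gt0.
have N0 : 0 < b + e / C by rewrite ltr_wpDl.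
have fN : (bmo_norm beta1 f < (b + e / C)%:E)%E by rewrite bE lte_fin ltrDl.
apply: le_trans (blo_maximal_le hbeta1 hbeta12 hbeta2 N0 fN fx0') _.
rewrite -EFinD lee_fin decay_stepE mulrAC -/C mulrDr mulrCA mulfV ?gt_eqF// mulr1.
exact: lexx.
Qed.
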